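(* Let $\mathcal{C}$ be a tri-exact category with $X,Z\in\mathcal{C}$ strongly indecomposable. Let $\Gamma\to\overline{\mathrm{End}}(X)$ and $\Sigma\to\underline{\mathrm{End}}(Z)$ be non-zero ring homomorphisms. Let ${}_\Gamma I$ be an injective cogenerator of the left $\Gamma$-module $S_X$ and $I_\Sigma$ an injective cogenerator of the right $\Sigma$-module $S_Z$. The following statements are equivalent. (1) There exists an almost split sequence $X\to Y\to Z$ in $\mathcal{C}$. (2) There exists a monomorphism of functors $\Psi:\mathrm{Ext}^1_{\mathcal{C}}(Z,-)\to\mathrm{Hom}_\Gamma(\overline{\mathrm{Hom}}_{\mathcal{C}}(-,X),{}_\Gamma I)$ such that the left $\overline{\mathrm{End}}(X)$-linear map $\Psi_X$ is socle essential. (3) There exists a monomorphism of functors $\Phi:\mathrm{Ext}^1_{\mathcal{C}}(-,X)\to\mathrm{Hom}_\Sigma(\underline{\mathrm{Hom}}_{\mathcal{C}}(Z,-),I_\Sigma)$ such that the right $\underline{\mathrm{End}}(Z)$-linear map $\Phi_Z$ is socle essential.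
   Context: A tri-exact category is a full subcategory $\mathcal{C}$ (containing $0$) of a triangulated category $\mathcal{A}$ which is extension-closed: for any exact triangle $X\to Y\to Z\to X[1]$ in $\mathcal{A}$ with $X,Z\in\mathcal{C}$, also $Y\in\mathcal{C}$. Put $\mathrm{Ext}^1_{\mathcal{C}}(X,Y)=\mathrm{Hom}_{\mathcal{A}}(X,Y[1])$; for $\delta\in\mathrm{Ext}^1_{\mathcal{C}}(X,Y)$, $f:M\to X$, $g:Y\to N$ in $\mathcal{C}$ set $\delta\cdot f=\delta\circ f$ and $g\cdot\delta=g[1]\circ\delta$. A sequence $X\to Y\to Z$ in $\mathcal{C}$ is a tri-exact sequence defined by $\delta\in\mathrm{Ext}^1_{\mathcal{C}}(Z,X)$ if it embeds in an exact triangle $X\to Y\to Z\xrightarrow{\delta}X[1]$ of $\mathcal{A}$. A morphism $f:X\to Y$ in an additive category is left minimal if every $h:Y\to Y$ with $hf=f$ is an automorphism; left almost split if it is not a section and every non-section $X\to M$ factors through $f$; minimal left almost split if both. Right minimal, right almost split, minimal right almost split are dual. A tri-exact sequence $X\xrightarrow{f}Y\xrightarrow{g}Z$ is an almost split sequence if $f$ is minimal left almost split and $g$ is minimal right almost split in $\mathcal{C}$. A morphism $f:X\to Y$ in $\mathcal{C}$ is injectively trivial if $f\cdot\delta=0$ for all $M\in\mathcal{C}$, $\delta\in\mathrm{Ext}^1_{\mathcal{C}}(M,X)$; projectively trivial if $\zeta\cdot f=0$ for all $M\in\mathcal{C}$, $\zeta\in\mathrm{Ext}^1_{\mathcal{C}}(Y,M)$.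 $\overline{\mathrm{Hom}}_{\mathcal{C}}$, $\overline{\mathrm{End}}$ (resp. $\underline{\mathrm{Hom}}_{\mathcal{C}}$, $\underline{\mathrm{End}}$) denote the Hom-groups and endomorphism rings modulo injectively (resp. projectively) trivial morphisms. $\mathrm{Ext}^1_{\mathcal{C}}(Z,X)$ is an $\overline{\mathrm{End}}(X)$-$\underline{\mathrm{End}}(Z)$-bimodule via $\cdot$. Through the given ring homomorphisms, $\overline{\mathrm{Hom}}_{\mathcal{C}}(L,X)$ is a left $\Gamma$-module and $\underline{\mathrm{Hom}}_{\mathcal{C}}(Z,L)$ is a right $\Sigma$-module for $L\in\mathcal{C}$. All functors have values in $\mathrm{Mod}\,\mathbb{Z}$. An object $M$ is strongly indecomposable if $\mathrm{End}(M)$ is local; then $S_M=\mathrm{End}(M)/\mathrm{rad}(\mathrm{End}(M))$, which is a simple left $\overline{\mathrm{End}}(M)$-module if $\overline{\mathrm{End}}(M)\neq0$ and a simple right $\underline{\mathrm{End}}(M)$-module if $\underline{\mathrm{End}}(M)\ne0$. Thus $S_X$ is a left $\Gamma$-module and $S_Z$ a right $\Sigma$-module. An injective cogenerator of a module $S$ is an injective module $I$ such that $S$ embeds in a product of copies of $I$. A linear map $f:M\to N$ of modules over a ring is socle essential if $\mathrm{Im}(f)\cap\mathrm{Soc}(N)\neq0$ whenever $\mathrm{Soc}(N)\neq0$; in (2) socles are taken over $\overline{\mathrm{End}}(X)$, in (3) over $\underline{\mathrm{End}}(Z)$. *)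

(* Defs.v *)
From HB Require Import structures.
From mathcomp Require Import all_boot ssralg ring_quotient boolp functions.

Set Implicit Arguments.
Unset Strict Implicit.
Unset Printing Implicit Defensive.

Import GRing.Theory.
Local Open Scope ring_scope.
Local Open Scope quotient_scope.

Reserved Notation "g \co f" (at level 40, left associativity).

(** * Rings and modules *)

(* Right modules over a ring R are modules over the converse ring R^c; for an
   endomorphism ring [endo X], the converse ring is written [endo_op X]. *)

Section Rings.
Variable R : pzRingType.

Definition invertible (a : R) : Prop := exists b, a * b = 1 /\ b * a = 1.

Definition local_ring : Prop :=
  (1 : R) <> 0 /\
  forall a b : R, ~ invertible a -> ~ invertible b -> ~ invertible (a + b).

Definition left_ideal (I : R -> Prop) : Prop :=
  [/\ I 0, forall a b, I a -> I b -> I (a + b)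
    & forall r a, I a -> I (r * a)].

Definition maximal_left_ideal (I : R -> Prop) : Prop :=
  [/\ left_ideal I, ~ I 1 &
      forall J, left_ideal J -> (forall a, I a -> J a) ->
        (forall a, J a -> I a) \/ (forall a, J a)].

Definition jacobson (a : R) : Prop :=
  forall I, maximal_left_ideal I -> I a.

Definition jacobson_pred : pred R := fun a => `[< jacobson a >].

Lemma left_ideal_sub I : left_ideal I ->
  forall a b, I a -> I b -> I (a - b).
Proof.
by case=> _ ID IM a b Ia Ib; apply: ID => //; rewrite -mulN1r; apply: IM.
Qed.

Lemma jacobson_zmod_closed : zmod_closed jacobson_pred.
Proof.
split=> [|a b /asboolP ja /asboolP jb]; apply/asboolP => I mI.
  by case: mI => -[].
by apply: left_ideal_sub; [case: mI | apply: ja | apply: jb].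
Qed.

HB.instance Definition _ :=
  GRing.isZmodClosed.Build R jacobson_pred jacobson_zmod_closed.

Lemma jacobsonP a : reflect (jacobson a) (a \in jacobson_pred).
Proof. exact: asboolP. Qed.

Lemma jacobsonMl r a : jacobson a -> jacobson (r * a).
Proof.
by move=> ja I mI; case: (mI) => -[_ _ IM] _ _; apply: IM; exact: ja.
Qed.

Section Local.
Hypothesis locR : local_ring.

Lemma local_compl a : ~ invertible a -> invertible (1 - a).
Proof.
move=> na; apply: contrapT => nb.
have := locR.2 _ _ na nb; rewrite addrC subrK; apply.
by exists 1; rewrite mulr1.
Qed.

Lemma local_linv a b : b * a = 1 -> invertible a.
Proof.
move=> ba1; have [[c [h1 h2]]|/local_compl [c [h1 h2]]] :=
  pselect (invertible (a * b)).
  exists b; split=> //; have idem : a * b * (a * b) = a * b.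
    by rewrite -mulrA [b * (a * b)]mulrA ba1 mul1r.
  by rewrite -[LHS]mulr1 -h1 mulrA idem.
case: locR => nz _; case: nz.
have b0 : b * (1 - a * b) = 0 by rewrite mulrBr mulr1 mulrA ba1 mul1r subrr.
have bE : b = 0 by rewrite -[b]mulr1 -h1 mulrA b0 mul0r.
by rewrite -ba1 bE mul0r.
Qed.

Lemma local_nonunitMl r a : ~ invertible a -> ~ invertible (r * a).
Proof.
by move=> na [c [_ h]]; apply/na/(@local_linv a (c * r)); rewrite -mulrA.
Qed.

Lemma local_nonunitMr r a : ~ invertible a -> ~ invertible (a * r).
Proof.
move=> na [c [h _]]; have [d [d1 d2]] : invertible (r * c).
  by apply: (@local_linv _ a); rewrite mulrA.
apply: na; exists (r * c); split; first by rewrite mulrA.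
have ad : a = d by rewrite -[LHS]mulr1 -d1 !mulrA h mul1r.
by rewrite ad.
Qed.

Lemma local_jacobsonP a : jacobson a <-> ~ invertible a.
Proof.
split=> [ja|na I [[I0 ID IM] I1 Imax]].
  apply: (ja (fun b => ~ invertible b)); split.
  - split; [|exact: locR.2|by move=> r b; exact: local_nonunitMl].
    by case=> b [h _]; case: locR => /eqP; rewrite -h mul0r eqxx.
  - by apply; exists 1; rewrite mulr1.
  - move=> J [J0 JD JM] _; have [J1|nJ1] := pselect (J 1).
      by right=> b; rewrite -[b]mulr1; apply: JM.
    by left=> b Jb [c [_ h]]; apply: nJ1; rewrite -h; apply: JM.
pose J b := exists c r, I c /\ b = c + r * a.
have lJ : left_ideal J.
  split; first by exists 0, 0; rewrite mul0r addr0.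
    move=> _ _ [c [r [Ic ->]]] [d [s [Id ->]]]; exists (c + d), (r + s).
    by split; [apply: ID | rewrite mulrDl addrACA].
  move=> t _ [c [r [Ic ->]]]; exists (t * c), (t * r).
  by split; [apply: IM | rewrite mulrDr mulrA].
case: (Imax J lJ) => [b Ib|JI|JT].
- by exists b, 0; rewrite mul0r addr0.
- by apply: JI; exists 0, 1; rewrite mul1r add0r.
have [c [r [Ic E1]]] := JT 1.
have : ~ invertible (c + r * a).
  apply: locR.2; last exact: local_nonunitMl.
  by case=> d [_ h]; apply: I1; rewrite -h; apply: IM.
by case; rewrite -E1; exists 1; rewrite mulr1.
Qed.

Lemma local_jacobsonMr r a : jacobson a -> jacobson (a * r).
Proof. by rewrite !local_jacobsonP; exact: local_nonunitMr. Qed.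

End Local.

Section Modules.
Variables M N : lmodType R.

Definition submodule (U : N -> Prop) : Prop :=
  [/\ U 0, forall x y, U x -> U y -> U (x + y) & forall a x, U x -> U (a *: x)].

Definition simple_submodule (U : N -> Prop) : Prop :=
  [/\ submodule U, exists x, U x /\ x <> 0 &
      forall V, submodule V -> (forall x, V x -> U x) ->
        (forall x, V x -> x = 0) \/ (forall x, U x -> V x)].

(* the sum of all the simple submodules *)
Definition socle (x : N) : Prop :=
  exists (n : nat) (s : 'I_n -> N),
    (forall i, exists U, simple_submodule U /\ U (s i)) /\
    x = \sum_(i < n) s i.

End Modules.

Definition socle_essential (M N : lmodType R) (f : {linear M -> N}) : Prop :=
  (exists y : N, socle y /\ y <> 0) ->
  exists x : M, socle (f x) /\ f x <> 0.

Definition injective_module (I : lmodType R) : Prop :=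
  forall (M N : lmodType R) (i : {linear M -> N}) (f : {linear M -> I}),
    injective i -> exists g : {linear N -> I}, forall x, g (i x) = f x.

(* [T -> I], with the pointwise structure, is the product of [T] copies of
   [I]. *)
Definition injective_cogenerator (S I : lmodType R) : Prop :=
  injective_module I /\
  exists (T : Type) (e : {linear S -> (T -> I)}), injective e.

End Rings.

Definition nonzero_morphism (R S : pzRingType) (phi : {rmorphism R -> S}) :
  Prop := exists a, phi a <> 0.

Lemma nonzero_morphism_codomain (R S : pzRingType) (phi : {rmorphism R -> S}) :
  nonzero_morphism phi -> (1 : S) <> 0.
Proof. by case=> a pa S10; apply: pa; rewrite -[LHS]mulr1 S10 mulr0. Qed.

(* restriction of scalars along phi *)
Definition restrict_scalars (R S : pzRingType) (phi : {rmorphism R -> S})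
  (M : lmodType S) : Type := M.

Section RestrictScalars.
Variables (R S : pzRingType) (phi : {rmorphism R -> S}) (M : lmodType S).

Local Notation restrict_scalars := (restrict_scalars phi M).

HB.instance Definition _ := GRing.Zmodule.copy restrict_scalars M.

Definition restrict_scale (a : R) (x : restrict_scalars) : restrict_scalars :=
  (phi a *: (x : M)).

Fact restrict_scaleA a b x :
  restrict_scale a (restrict_scale b x) = restrict_scale (a * b) x.
Proof. by rewrite /restrict_scale rmorphM scalerA. Qed.

Fact restrict_scale1 : left_id 1 restrict_scale.
Proof. by move=> x; rewrite /restrict_scale rmorph1 scale1r. Qed.

Fact restrict_scaleDr : right_distributive restrict_scale +%R.
Proof. by move=> a x y; exact: (scalerDr (phi a) (x : M) y). Qed.

Fact restrict_scaleDl x : {morph restrict_scale^~ x : a b / a + b}.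
Proof.
by move=> a b; rewrite /restrict_scale rmorphD; exact: (scalerDl (x : M)).
Qed.

HB.instance Definition _ := GRing.Zmodule_isLmodule.Build R restrict_scalars
  restrict_scaleA restrict_scale1 restrict_scaleDr restrict_scaleDl.
End RestrictScalars.

(* the additive group Hom_R(M, N) *)
Section LinearMaps.
Variables (R : pzRingType) (M N : lmodType R).

Definition linHom : Type := {linear M -> N}.

Implicit Types f g : linHom.

Lemma linHomP f g :
  (forall x, (f : {linear M -> N}) x = (g : {linear M -> N}) x) -> f = g.
Proof.
move=> fg; case: f g fg => [f cf] [g cg] /= /funext fg.
case: _ / fg in cg *; case: cf cg => [[fa] [fs]] [[ga] [gs]].
by rewrite (Prop_irrelevance fa ga) (Prop_irrelevance fs gs).
Qed.

HB.instance Definition _ := gen_eqMixin linHom.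
HB.instance Definition _ := gen_choiceMixin linHom.

Definition linHom0 : linHom := (\0 : M -> N)%R.
Definition linHomN f : linHom := (\- (f : {linear M -> N}) : M -> N)%R.
Definition linHomD f g : linHom :=
  ((f : {linear M -> N}) \+ (g : {linear M -> N}) : M -> N)%R.

Fact linHomDA : associative linHomD.
Proof. by move=> f g h; apply: linHomP => x /=; rewrite addrA. Qed.
Fact linHomDC : commutative linHomD.
Proof. by move=> f g; apply: linHomP => x /=; rewrite addrC. Qed.
Fact linHom0D : left_id linHom0 linHomD.
Proof. by move=> f; apply: linHomP => x /=; rewrite add0r. Qed.
Fact linHomND : left_inverse linHom0 linHomN linHomD.
Proof. by move=> f; apply: linHomP => x /=; rewrite addNr. Qed.

HB.instance Definition _ :=
  GRing.isZmodule.Build linHom linHomDA linHomDC linHom0D linHomND.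
End LinearMaps.

(** * Preadditive categories *)

Record preadditive : Type := Preadditive {
  obj :> Type;
  hom : obj -> obj -> zmodType;
  idm : forall X, hom X X;
  hcomp : forall X Y Z, hom Y Z -> hom X Y -> hom X Z;
  compA : forall W X Y Z (h : hom Y Z) (g : hom X Y) (f : hom W X),
    hcomp h (hcomp g f) = hcomp (hcomp h g) f;
  comp1m : forall X Y (f : hom X Y), hcomp (idm Y) f = f;
  compm1 : forall X Y (f : hom X Y), hcomp f (idm X) = f;
  compDl : forall X Y Z (g g' : hom Y Z) (f : hom X Y),
    hcomp (g + g') f = hcomp g f + hcomp g' f;
  compDr : forall X Y Z (g : hom Y Z) (f f' : hom X Y),
    hcomp g (f + f') = hcomp g f + hcomp g f'
}.

Arguments hom {C} X Y : rename.
Arguments idm {C} X : rename.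
Arguments hcomp {C X Y Z} g f : rename.

Notation "g \co f" := (hcomp g f).

Section CompTheory.
Variable C : preadditive.
Implicit Types X Y Z : C.

Lemma comp_zmod_morphismr X Y Z (g : hom Y Z) :
  zmod_morphism (fun f : hom X Y => g \co f).
Proof.
move=> f f'; apply: (addIr (g \co f')).
by rewrite subrK -compDr subrK.
Qed.

Lemma comp_zmod_morphisml X Y Z (f : hom X Y) :
  zmod_morphism (fun g : hom Y Z => g \co f).
Proof.
move=> g g'; apply: (addIr (g' \co f)).
by rewrite subrK -compDl subrK.
Qed.

Lemma compBr X Y Z (g : hom Y Z) (f f' : hom X Y) :
  g \co (f - f') = g \co f - g \co f'.
Proof. exact: comp_zmod_morphismr. Qed.

Lemma compBl X Y Z (g g' : hom Y Z) (f : hom X Y) :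
  (g - g') \co f = g \co f - g' \co f.
Proof. exact: comp_zmod_morphisml. Qed.

Lemma compm0 X Y Z (g : hom Y Z) : g \co (0 : hom X Y) = 0.
Proof. by rewrite -(subrr 0) compBr subrr. Qed.

Lemma comp0m X Y Z (f : hom X Y) : (0 : hom Y Z) \co f = 0.
Proof. by rewrite -(subrr 0) compBl subrr. Qed.

Definition isomorphism X Y (f : hom X Y) : Prop :=
  exists g : hom Y X, g \co f = idm X /\ f \co g = idm Y.

Definition is_section X Y (f : hom X Y) : Prop :=
  exists r : hom Y X, r \co f = idm X.

Definition is_retraction X Y (g : hom X Y) : Prop :=
  exists s : hom Y X, g \co s = idm Y.

Definition left_minimal X Y (f : hom X Y) : Prop :=
  forall h : hom Y Y, h \co f = f -> isomorphism h.

Definition right_minimal X Y (g : hom X Y) : Prop :=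
  forall h : hom X X, g \co h = g -> isomorphism h.

Definition left_almost_split X Y (f : hom X Y) : Prop :=
  ~ is_section f /\
  forall M (u : hom X M), ~ is_section u -> exists v : hom Y M, u = v \co f.

Definition right_almost_split X Y (g : hom X Y) : Prop :=
  ~ is_retraction g /\
  forall M (u : hom M Y), ~ is_retraction u -> exists v : hom M X, u = g \co v.

Definition minimal_left_almost_split X Y (f : hom X Y) : Prop :=
  left_minimal f /\ left_almost_split f.

Definition minimal_right_almost_split X Y (g : hom X Y) : Prop :=
  right_minimal g /\ right_almost_split g.

Definition zero_object (O : C) : Prop :=
  forall X, (forall f : hom X O, f = 0) /\ (forall f : hom O X, f = 0).

Definition is_biproduct X Y S (i : hom X S) (j : hom Y S)
    (p : hom S X) (q : hom S Y) : Prop :=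
  [/\ p \co i = idm X, q \co j = idm Y, q \co i = 0, p \co j = 0
    & i \co p + j \co q = idm S].

End CompTheory.

Section Opposite.
Variable C : preadditive.

Definition opp_comp (X Y Z : C) (g : hom Z Y) (f : hom Y X) : hom Z X :=
  f \co g.

Definition opposite : preadditive.
Proof.
refine (@Preadditive C (fun X Y => hom Y X) (@idm C) opp_comp _ _ _ _ _);
  rewrite /opp_comp.
- by move=> *; rewrite compA.
- by move=> *; rewrite compm1.
- by move=> *; rewrite comp1m.
- by move=> *; rewrite compDr.
- by move=> *; rewrite compDl.
Defined.
End Opposite.

Section FullSubcategory.
Variables (A : preadditive) (P : A -> Prop).

Definition full_subcategory : preadditive :=
  @Preadditive {X : A | P X} (fun X Y => hom (sval X) (sval Y))
    (fun X => idm (sval X)) (fun X Y Z g f => g \co f)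
    (fun _ _ _ _ => @compA A _ _ _ _) (fun _ _ => @comp1m A _ _)
    (fun _ _ => @compm1 A _ _) (fun _ _ _ => @compDl A _ _ _)
    (fun _ _ _ => @compDr A _ _ _).
End FullSubcategory.

(* Endomorphism rings and the modules Hom(L, X) over End(X) and Hom(Z, L)
   over End(Z) *)
Section Endomorphisms.
Variable C : preadditive.
Implicit Types L X Z : C.

Definition endo X : Type := hom X X.

HB.instance Definition _ X := GRing.Zmodule.copy (endo X) (hom X X).

Definition endo_mul X (g f : endo X) : endo X := g \co f.

Fact endo_mulA X : associative (@endo_mul X).
Proof. by move=> h g f; exact: compA. Qed.
Fact endo_mul1r X : left_id (idm X : endo X) (@endo_mul X).
Proof. by move=> f; exact: comp1m. Qed.
Fact endo_mulr1 X : right_id (idm X : endo X) (@endo_mul X).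
Proof. by move=> f; exact: compm1. Qed.
Fact endo_mulDl X : left_distributive (@endo_mul X) +%R.
Proof. by move=> g g' f; exact: compDl. Qed.
Fact endo_mulDr X : right_distributive (@endo_mul X) +%R.
Proof. by move=> g f f'; exact: compDr. Qed.

HB.instance Definition _ X := GRing.Zmodule_isPzRing.Build (endo X)
  (@endo_mulA X) (@endo_mul1r X) (@endo_mulr1 X) (@endo_mulDl X)
  (@endo_mulDr X).

(* The converse ring (endo X)^c, as a type with its own ring structure
   rather than through [GRing.converse], whose unfolding makes canonical
   structure inference very slow. *)
Definition endo_op X : Type := hom X X.

HB.instance Definition _ X := GRing.Zmodule.copy (endo_op X) (hom X X).

Definition endo_op_mul X (g f : endo_op X) : endo_op X := f \co g.

Fact endo_op_mulA X : associative (@endo_op_mul X).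
Proof. by move=> h g f; symmetry; exact: compA. Qed.
Fact endo_op_mul1r X : left_id (idm X : endo_op X) (@endo_op_mul X).
Proof. by move=> f; exact: compm1. Qed.
Fact endo_op_mulr1 X : right_id (idm X : endo_op X) (@endo_op_mul X).
Proof. by move=> f; exact: comp1m. Qed.
Fact endo_op_mulDl X : left_distributive (@endo_op_mul X) +%R.
Proof. by move=> g g' f; exact: compDr. Qed.
Fact endo_op_mulDr X : right_distributive (@endo_op_mul X) +%R.
Proof. by move=> g f f'; exact: compDl. Qed.

HB.instance Definition _ X := GRing.Zmodule_isPzRing.Build (endo_op X)
  (@endo_op_mulA X) (@endo_op_mul1r X) (@endo_op_mulr1 X) (@endo_op_mulDl X)
  (@endo_op_mulDr X).

Definition homL L X : Type := hom L X.

HB.instance Definition _ L X := GRing.Zmodule.copy (homL L X) (hom L X).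

Definition homL_scale L X (a : endo X) (u : homL L X) : homL L X := a \co u.

Fact homL_scaleA L X a b (u : homL L X) :
  homL_scale a (homL_scale b u) = homL_scale (a * b) u.
Proof. exact: compA. Qed.
Fact homL_scale1 L X : left_id 1 (@homL_scale L X).
Proof. by move=> u; exact: comp1m. Qed.
Fact homL_scaleDr L X : right_distributive (@homL_scale L X) +%R.
Proof. by move=> a u v; exact: compDr. Qed.
Fact homL_scaleDl L X (u : homL L X) :
  {morph (@homL_scale L X)^~ u : a b / a + b}.
Proof. by move=> a b; exact: compDl. Qed.

HB.instance Definition _ L X :=
  GRing.Zmodule_isLmodule.Build (endo X) (homL L X)
    (@homL_scaleA L X) (@homL_scale1 L X) (@homL_scaleDr L X)
    (@homL_scaleDl L X).

Definition homR Z L : Type := hom Z L.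

HB.instance Definition _ Z L := GRing.Zmodule.copy (homR Z L) (hom Z L).

Definition homR_scale Z L (a : (endo_op Z)) (u : homR Z L) : homR Z L :=
  u \co (a : hom Z Z).

Fact homR_scaleA Z L a b (u : homR Z L) :
  homR_scale a (homR_scale b u) = homR_scale (a * b) u.
Proof. by symmetry; exact: compA. Qed.
Fact homR_scale1 Z L : left_id 1 (@homR_scale Z L).
Proof. by move=> u; exact: compm1. Qed.
Fact homR_scaleDr Z L : right_distributive (@homR_scale Z L) +%R.
Proof. by move=> a u v; exact: compDl. Qed.
Fact homR_scaleDl Z L (u : homR Z L) :
  {morph (@homR_scale Z L)^~ u : a b / a + b}.
Proof. by move=> a b; exact: compDr. Qed.

HB.instance Definition _ Z L :=
  GRing.Zmodule_isLmodule.Build (endo_op Z) (homR Z L)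
    (@homR_scaleA Z L) (@homR_scale1 Z L) (@homR_scaleDr Z L)
    (@homR_scaleDl Z L).

Definition rmorph_op_fun (R : pzRingType) X (psi : {rmorphism R -> endo X})
  (a : R^c) : endo_op X := psi a.

Fact rmorph_op_zmod (R : pzRingType) X (psi : {rmorphism R -> endo X}) :
  zmod_morphism (rmorph_op_fun psi).
Proof. exact: (rmorphB psi). Qed.

Fact rmorph_op_monoid (R : pzRingType) X (psi : {rmorphism R -> endo X}) :
  monoid_morphism (rmorph_op_fun psi).
Proof.
by split=> [|a b]; [exact: (rmorph1 psi) | exact: (rmorphM psi b a)].
Qed.

HB.instance Definition _ (R : pzRingType) X (psi : {rmorphism R -> endo X}) :=
  GRing.isZmodMorphism.Build R^c (endo_op X) (rmorph_op_fun psi)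
    (rmorph_op_zmod psi).
HB.instance Definition _ (R : pzRingType) X (psi : {rmorphism R -> endo X}) :=
  GRing.isMonoidMorphism.Build R^c (endo_op X) (rmorph_op_fun psi)
    (rmorph_op_monoid psi).

(* a ring morphism R -> End(X), seen as a morphism R^c -> End(X)^c *)
Definition rmorph_op (R : pzRingType) X (psi : {rmorphism R -> endo X}) :
  {rmorphism R^c -> endo_op X} := rmorph_op_fun psi.

Definition strongly_indecomposable X : Prop := local_ring (endo X).

End Endomorphisms.

(** * Additive quotients *)

Record hom_ideal (C : preadditive) : Type := HomIdeal {
  ideal_mem : forall X Y : C, hom X Y -> Prop;
  ideal0 : forall X Y : C, ideal_mem (0 : hom X Y);
  idealB : forall (X Y : C) (f g : hom X Y),
    ideal_mem f -> ideal_mem g -> ideal_mem (f - g);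
  idealMl : forall (X Y Z : C) (g : hom Y Z) (f : hom X Y),
    ideal_mem f -> ideal_mem (g \co f);
  idealMr : forall (X Y Z : C) (g : hom Y Z) (f : hom X Y),
    ideal_mem g -> ideal_mem (g \co f)
}.

Section QuotientCategory.
Variables (C : preadditive) (J : hom_ideal C).
Implicit Types W X Y Z : C.

Definition ideal_pred X Y : pred (hom X Y) := fun f => `[< ideal_mem J f >].

Lemma ideal_zmod_closed X Y : zmod_closed (@ideal_pred X Y).
Proof.
split=> [|f g /asboolP Jf /asboolP Jg]; apply/asboolP.
  exact: ideal0.
exact: idealB.
Qed.

HB.instance Definition _ X Y :=
  GRing.isZmodClosed.Build (hom X Y) (@ideal_pred X Y)
    (@ideal_zmod_closed X Y).

Definition qhom X Y : zmodType :=
  Quotient.quot (GRing.ZmodClosed.clone (hom X Y) (@ideal_pred X Y) _).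

Definition proj X Y (f : hom X Y) : qhom X Y := \pi_(qhom X Y) f.

Lemma projP X Y (f g : hom X Y) : proj f = proj g <-> ideal_mem J (f - g).
Proof.
rewrite /proj; split=> [/eqP|Jfg]; last apply/eqP.
  by rewrite -Quotient.idealrBE => /asboolP.
by rewrite -Quotient.idealrBE; apply/asboolP.
Qed.

Lemma proj_zmod X Y : zmod_morphism (@proj X Y).
Proof. exact: (raddfB \pi_(qhom X Y)). Qed.

Lemma projK X Y (a : qhom X Y) : proj (repr a) = a.
Proof. exact: reprK. Qed.

HB.instance Definition _ X Y :=
  GRing.isZmodMorphism.Build (hom X Y) (qhom X Y) (@proj X Y) (@proj_zmod X Y).

Definition qcomp X Y Z (b : qhom Y Z) (a : qhom X Y) : qhom X Z :=
  proj (repr b \co repr a).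

Lemma qcompE X Y Z (g : hom Y Z) (f : hom X Y) :
  qcomp (proj g) (proj f) = proj (g \co f).
Proof.
have Jg : ideal_mem J (repr (proj g) - g) by apply/projP; rewrite projK.
have Jf : ideal_mem J (repr (proj f) - f) by apply/projP; rewrite projK.
apply/projP; set g' := repr _ in Jg *; set f' := repr _ in Jf *.
have -> : g' \co f' - g \co f = (g' - g) \co f' - g \co (f - f').
  by rewrite compBl compBr opprB addrA subrK.
apply: idealB; first exact: idealMr.
by apply: idealMl; rewrite -opprB -sub0r; apply: idealB => //; apply: ideal0.
Qed.

Definition quotient_category : preadditive.
Proof.
refine (@Preadditive C qhom (fun X => proj (idm X)) qcomp _ _ _ _ _).
- move=> W X Y Z h g f; rewrite -[h]projK -[g]projK -[f]projK !qcompE.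
  by rewrite compA.
- by move=> X Y f; rewrite -[f]projK qcompE comp1m.
- by move=> X Y f; rewrite -[f]projK qcompE compm1.
- move=> X Y Z g g' f; rewrite -[g]projK -[g']projK -[f]projK.
  by rewrite -raddfD !qcompE compDl raddfD.
- move=> X Y Z g f f'; rewrite -[g]projK -[f']projK -[f]projK.
  by rewrite -raddfD !qcompE compDr raddfD.
Defined.

End QuotientCategory.

(** * The simple top of a strongly indecomposable object *)

(* S_X = End(X) / rad End(X).  For an ideal J of C and D = C / J, it is a
   module over End_D(X) as soon as End(X) is local and End_D(X) is non-zero:
   J(X, X) is then a proper ideal of End(X), hence contained in the
   radical. *)
Section Top.
Variables (C : preadditive) (J : hom_ideal C) (X : C).
Local Notation D := (quotient_category J).
Hypothesis locX : strongly_indecomposable X.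
Hypothesis nzX : (1 : endo (X : D)) <> 0.

Definition simple_top : zmodType :=
  Quotient.quot (GRing.ZmodClosed.clone (endo X) (@jacobson_pred (endo X)) _).

Definition top_pi (f : endo X) : simple_top := \pi_simple_top f.

Lemma top_piP (f g : endo X) : top_pi f = top_pi g <-> jacobson (f - g).
Proof.
rewrite /top_pi; split=> [/eqP|Jfg]; last apply/eqP.
  by rewrite -Quotient.idealrBE => /asboolP.
by rewrite -Quotient.idealrBE; apply/asboolP.
Qed.

Lemma top_pi_zmod : zmod_morphism top_pi.
Proof. exact: (raddfB \pi_simple_top). Qed.

HB.instance Definition _ :=
  GRing.isZmodMorphism.Build (endo X) simple_top top_pi top_pi_zmod.

Lemma top_piK (s : simple_top) : top_pi (repr s) = s.
Proof. exact: reprK. Qed.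

Lemma ideal_jacobson (f : endo X) : ideal_mem J f -> jacobson f.
Proof using locX nzX.
move=> Jf; apply/(local_jacobsonP locX) => -[g [fg _]]; apply: nzX.
have : ideal_mem J (idm X : hom X X) by rewrite -[idm X]fg; apply: idealMr.
move=> J1; have : proj J (idm X) = proj J 0 by apply/projP; rewrite subr0.
by rewrite raddf0.
Qed.

Lemma top_pi0 (f : endo X) : jacobson f -> top_pi f = 0.
Proof.
by move=> jf; rewrite -(raddf0 top_pi); apply/top_piP; rewrite subr0.
Qed.

Definition topL_mul (a : endo (X : D)) (s : simple_top) : simple_top :=
  top_pi ((repr (a : qhom J X X) : endo X) * repr s).

Definition topR_mul (a : endo (X : D)) (s : simple_top) : simple_top :=
  top_pi (repr s * (repr (a : qhom J X X) : endo X)).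

Lemma topL_mulE (f s : endo X) :
  topL_mul (proj J f) (top_pi s) = top_pi (f * s).
Proof using locX nzX.
apply/top_piP; set f' := repr _; set s' := repr _.
have jf : jacobson ((f' : endo X) - f).
  by apply: ideal_jacobson; apply/projP; rewrite /f' projK.
have js : jacobson (s - s').
  by apply/top_piP; rewrite /s' top_piK.
have -> : (f' : endo X) * s' - f * s = ((f' : endo X) - f) * s' - f * (s - s').
  by rewrite mulrBl mulrBr opprB addrA subrK.
apply/jacobsonP/rpredB; apply/jacobsonP; last exact: jacobsonMl.
exact: local_jacobsonMr.
Qed.

Lemma topR_mulE (f s : endo X) :
  topR_mul (proj J f) (top_pi s) = top_pi (s * f).
Proof using locX nzX.
apply/top_piP; set s' := repr _; set f' := repr _.
have jf : jacobson ((f' : endo X) - f).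
  by apply: ideal_jacobson; apply/projP; rewrite /f' projK.
have js : jacobson (s - s').
  by apply/top_piP; rewrite /s' top_piK.
have -> : s' * (f' : endo X) - s * f = s' * ((f' : endo X) - f) - (s - s') * f.
  by rewrite mulrBl mulrBr opprB addrA subrK.
apply/jacobsonP/rpredB; apply/jacobsonP; last exact: local_jacobsonMr.
exact: jacobsonMl.
Qed.
End Top.

(* S_X as a left, resp. right, End_D(X)-module *)
Definition topL (C : preadditive) (J : hom_ideal C) (X : C)
  (locX : strongly_indecomposable X)
  (nzX : (1 : endo (X : quotient_category J)) <> 0) : Type := simple_top X.

Definition topR (C : preadditive) (J : hom_ideal C) (X : C)
  (locX : strongly_indecomposable X)
  (nzX : (1 : endo (X : quotient_category J)) <> 0) : Type := simple_top X.

Section TopModules.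
Variables (C : preadditive) (J : hom_ideal C) (X : C).
Local Notation D := (quotient_category J).
Variables (locX : strongly_indecomposable X) (nzX : (1 : endo (X : D)) <> 0).

Local Notation topL := (topL locX nzX).

HB.instance Definition _ := GRing.Zmodule.copy topL (simple_top X).

Definition topL_scale (a : endo (X : D)) (s : topL) : topL :=
  topL_mul (a : endo (X : quotient_category J)) (s : simple_top X).

Fact topL_scaleA a b s :
  topL_scale a (topL_scale b s) = topL_scale (a * b) s.
Proof.
have <- := projK (a : qhom J X X); have <- := projK (b : qhom J X X).
rewrite -[s](@top_piK C X) /topL_scale (topL_mulE locX nzX).
rewrite (topL_mulE locX nzX) mulrA -(topL_mulE locX nzX) -qcompE.
by [].
Qed.
Fact topL_scale1 : left_id 1 topL_scale.
Proof.
move=> s; rewrite -[s](@top_piK C X) /topL_scale.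
by rewrite [1]/(proj J (idm X)) (topL_mulE locX nzX) [idm X]/(1 : endo X) mul1r.
Qed.
Fact topL_scaleDr : right_distributive topL_scale +%R.
Proof.
move=> a s t; have <- := projK (a : qhom J X X).
rewrite -[s](@top_piK C X) -[t](@top_piK C X) /topL_scale.
rewrite [top_pi _ + top_pi _](_ : _ =
    top_pi (repr (s : simple_top X) + repr (t : simple_top X)));
  last by rewrite raddfD.
by rewrite !(topL_mulE locX nzX) mulrDr raddfD.
Qed.
Fact topL_scaleDl s : {morph topL_scale^~ s : a b / a + b}.
Proof.
move=> a b; rewrite -[s](@top_piK C X) /topL_scale /=.
have <- := projK (a : qhom J X X); have <- := projK (b : qhom J X X).
rewrite [_ + _](_ : _ = proj J (repr (a : qhom J X X) + repr (b : qhom J X X)));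
  last by rewrite raddfD.
by rewrite !(topL_mulE locX nzX) mulrDl raddfD.
Qed.

HB.instance Definition _ := GRing.Zmodule_isLmodule.Build (endo (X : D)) topL
  topL_scaleA topL_scale1 topL_scaleDr topL_scaleDl.

Local Notation topR := (topR locX nzX).

HB.instance Definition _ := GRing.Zmodule.copy topR (simple_top X).

Definition topR_scale (a : endo_op (X : D)) (s : topR) : topR :=
  topR_mul (a : endo (X : quotient_category J)) (s : simple_top X).

Fact topR_scaleA a b s :
  topR_scale a (topR_scale b s) = topR_scale (a * b) s.
Proof.
have <- := projK (a : qhom J X X); have <- := projK (b : qhom J X X).
rewrite -[s](@top_piK C X) /topR_scale (topR_mulE locX nzX).
rewrite (topR_mulE locX nzX) -mulrA -(topR_mulE locX nzX) -qcompE.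
by [].
Qed.
Fact topR_scale1 : left_id 1 topR_scale.
Proof.
move=> s; rewrite -[s](@top_piK C X) /topR_scale.
by rewrite [1]/(proj J (idm X)) (topR_mulE locX nzX) [idm X]/(1 : endo X) mulr1.
Qed.
Fact topR_scaleDr : right_distributive topR_scale +%R.
Proof.
move=> a s t; have <- := projK (a : qhom J X X).
rewrite -[s](@top_piK C X) -[t](@top_piK C X) /topR_scale.
rewrite [top_pi _ + top_pi _](_ : _ =
    top_pi (repr (s : simple_top X) + repr (t : simple_top X)));
  last by rewrite raddfD.
by rewrite !(topR_mulE locX nzX) mulrDl raddfD.
Qed.
Fact topR_scaleDl s : {morph topR_scale^~ s : a b / a + b}.
Proof.
move=> a b; rewrite -[s](@top_piK C X) /topR_scale /=.
have <- := projK (a : qhom J X X); have <- := projK (b : qhom J X X).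
rewrite [_ + _](_ : _ = proj J (repr (a : qhom J X X) + repr (b : qhom J X X)));
  last by rewrite raddfD.
by rewrite !(topR_mulE locX nzX) mulrDr raddfD.
Qed.

HB.instance Definition _ := GRing.Zmodule_isLmodule.Build (endo_op (X : D)) topR
  topR_scaleA topR_scale1 topR_scaleDr topR_scaleDl.
End TopModules.

(** * Additive functors to abelian groups *)

(* covariant on C; a contravariant functor on C is one on [opposite C] *)
Record abfunctor (C : preadditive) : Type := AbFunctor {
  fobj :> C -> zmodType;
  fmap : forall X Y, hom X Y -> {additive fobj X -> fobj Y};
  fmapD : forall X Y (f g : hom X Y) x, fmap (f + g) x = fmap f x + fmap g x;
  fmap1 : forall X x, fmap (idm X) x = x;
  fmapM : forall X Y Z (g : hom Y Z) (f : hom X Y) x,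
    fmap (g \co f) x = fmap g (fmap f x)
}.

Record nattrans (C : preadditive) (F G : abfunctor C) : Type := NatTrans {
  component :> forall X, {additive F X -> G X};
  naturality : forall X Y (f : hom X Y) x,
    component Y (fmap F f x) = fmap G f (component X x)
}.

Definition monomorphism (C : preadditive) (F G : abfunctor C)
    (Psi : nattrans F G) : Prop :=
  forall (H : abfunctor C) (a b : nattrans H F),
    (forall X x, Psi X (a X x) = Psi X (b X x)) ->
    forall X x, a X x = b X x.

(** * The functors Hom_R(Hom_D(-, X), I) and Hom_R(Hom_D(Z, -), I) *)

Section DualLeft.
Variables (C : preadditive) (J : hom_ideal C) (X : C).
Local Notation D := (quotient_category J).
Variables (R : pzRingType) (phi : {rmorphism R -> endo (X : D)}).
Variable I : lmodType R.

Definition dualL (L : C) : Type :=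
  linHom (restrict_scalars phi (homL (L : D) (X : D))) I.

HB.instance Definition _ L := GRing.Zmodule.on (dualL L).

Definition precomp (L M : D) (a : hom L M) :
    restrict_scalars phi (homL M (X : D)) ->
    restrict_scalars phi (homL L (X : D)) :=
  fun u => (u : hom M (X : D)) \co a.

Fact precomp_zmod L M a : zmod_morphism (@precomp L M a).
Proof. exact: comp_zmod_morphisml. Qed.
Fact precomp_scalable L M a : scalable (@precomp L M a).
Proof. by move=> r u; symmetry; exact: (@compA D). Qed.

HB.instance Definition _ L M a :=
  GRing.isZmodMorphism.Build _ _ (@precomp L M a) (@precomp_zmod L M a).
HB.instance Definition _ L M a :=
  GRing.isScalable.Build _ _ _ _ (@precomp L M a) (@precomp_scalable L M a).

Definition dualL_map (L M : D) (a : hom L M) (h : dualL L) : dualL M :=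
  (h : {linear _ -> _}) \o precomp a.

Lemma dualL_mapE (L M : D) (a : hom L M) (h : dualL L) u :
  (dualL_map a h : {linear _ -> _}) u =
  (h : {linear _ -> _}) ((u : hom M (X : D)) \co a).
Proof. by []. Qed.

Fact dualL_map_zmod L M a : zmod_morphism (@dualL_map L M a).
Proof. by move=> h k; apply: linHomP. Qed.

HB.instance Definition _ L M a :=
  GRing.isZmodMorphism.Build _ _ (@dualL_map L M a) (@dualL_map_zmod L M a).

Fact dualL_mapD L M (a b : @hom D L M) h :
  dualL_map (a + b) h = dualL_map a h + dualL_map b h.
Proof.
by apply: linHomP => u; rewrite [RHS]/= !dualL_mapE compDr raddfD.
Qed.
Fact dualL_map1 L h : dualL_map (@idm D L) h = h.
Proof. by apply: linHomP => u; rewrite dualL_mapE compm1. Qed.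
Fact dualL_mapM L M N (b : @hom D M N) (a : @hom D L M) h :
  dualL_map (b \co a) h = dualL_map b (dualL_map a h).
Proof. by apply: linHomP => u; rewrite !dualL_mapE compA. Qed.

Definition dualL_functor : abfunctor C.
Proof.
refine (@AbFunctor C dualL (fun L M g => dualL_map (proj J g : @hom D L M))
  _ _ _).
- by move=> L M f g h /=; rewrite raddfD dualL_mapD.
- by move=> L h /=; exact: dualL_map1.
- move=> L M N g f h /=; rewrite -dualL_mapM; congr dualL_map.
  by rewrite -qcompE.
Defined.

(* Hom_R(Hom_D(L, X), I) as a left End_D(L)-module: (a h)(u) = h(u a) *)
Fact dualL_scaleA (L : D) (a b : endo L) h :
  dualL_map a (dualL_map b h) = dualL_map (a * b) h.
Proof. by rewrite -dualL_mapM. Qed.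
Fact dualL_scaleDr (L : D) :
  right_distributive (@dualL_map L L : endo L -> _) +%R.
Proof. by move=> a h k; exact: raddfD. Qed.
Fact dualL_scaleDl (L : D) h :
  {morph (@dualL_map L L)^~ h : a b / a + b}.
Proof. by move=> a b; exact: dualL_mapD. Qed.

HB.instance Definition _ (L : D) :=
  GRing.Zmodule_isLmodule.Build (endo L) (dualL L)
    (@dualL_scaleA L) (@dualL_map1 L) (@dualL_scaleDr L) (@dualL_scaleDl L).
End DualLeft.

Section DualRight.
Variables (C : preadditive) (J : hom_ideal C) (Z : C).
Local Notation D := (quotient_category J).
Variables (R : pzRingType) (psi : {rmorphism R -> endo_op (Z : D)}).
Variable I : lmodType R.

Definition dualR (L : C) : Type :=
  linHom (restrict_scalars psi (homR (Z : D) (L : D))) I.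

HB.instance Definition _ L := GRing.Zmodule.on (dualR L).

Definition postcomp (L M : D) (a : hom L M) :
    restrict_scalars psi (homR (Z : D) L) ->
    restrict_scalars psi (homR (Z : D) M) :=
  fun u => a \co (u : hom (Z : D) L).

Fact postcomp_zmod L M a : zmod_morphism (@postcomp L M a).
Proof. exact: comp_zmod_morphismr. Qed.
Fact postcomp_scalable L M a : scalable (@postcomp L M a).
Proof. by move=> r u; exact: (@compA D). Qed.

HB.instance Definition _ L M a :=
  GRing.isZmodMorphism.Build _ _ (@postcomp L M a) (@postcomp_zmod L M a).
HB.instance Definition _ L M a :=
  GRing.isScalable.Build _ _ _ _ (@postcomp L M a) (@postcomp_scalable L M a).

Definition dualR_map (L M : D) (a : hom L M) (h : dualR M) : dualR L :=
  (h : {linear _ -> _}) \o postcomp a.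

Lemma dualR_mapE (L M : D) (a : hom L M) (h : dualR M) u :
  (dualR_map a h : {linear _ -> _}) u =
  (h : {linear _ -> _}) (a \co (u : hom (Z : D) L)).
Proof. by []. Qed.

Fact dualR_map_zmod L M a : zmod_morphism (@dualR_map L M a).
Proof. by move=> h k; apply: linHomP. Qed.

HB.instance Definition _ L M a :=
  GRing.isZmodMorphism.Build _ _ (@dualR_map L M a) (@dualR_map_zmod L M a).

Fact dualR_mapD L M (a b : @hom D L M) h :
  dualR_map (a + b) h = dualR_map a h + dualR_map b h.
Proof.
by apply: linHomP => u; rewrite [RHS]/= !dualR_mapE compDl raddfD.
Qed.
Fact dualR_map1 L h : dualR_map (@idm D L) h = h.
Proof. by apply: linHomP => u; rewrite dualR_mapE comp1m. Qed.
Fact dualR_mapM L M N (b : @hom D M N) (a : @hom D L M) h :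
  dualR_map (b \co a) h = dualR_map a (dualR_map b h).
Proof. by apply: linHomP => u; rewrite !dualR_mapE compA. Qed.

Definition dualR_functor : abfunctor (opposite C).
Proof.
refine (@AbFunctor (opposite C) dualR
  (fun M L (g : @hom C L M) => dualR_map (proj J g : @hom D L M)) _ _ _).
- by move=> L M f g h /=; rewrite raddfD dualR_mapD.
- by move=> L h /=; exact: dualR_map1.
- move=> L M N g f h /=; rewrite -dualR_mapM; congr dualR_map.
  by rewrite -qcompE.
Defined.

(* Hom_R(Hom_D(Z, L), I) as a right End_D(L)-module: (h a)(u) = h(a u) *)
Fact dualR_scaleA (L : D) (a b : (endo_op L)) h :
  dualR_map (a : endo L) (dualR_map (b : endo L) h) =
  dualR_map (a * b : (endo_op L)) h.
Proof. by rewrite -dualR_mapM. Qed.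
Fact dualR_scaleDr (L : D) :
  right_distributive (@dualR_map L L : (endo_op L) -> _) +%R.
Proof. by move=> a h k; exact: raddfD. Qed.
Fact dualR_scaleDl (L : D) h :
  {morph (@dualR_map L L)^~ h : a b / a + b}.
Proof. by move=> a b; exact: dualR_mapD. Qed.

HB.instance Definition _ (L : D) :=
  GRing.Zmodule_isLmodule.Build (endo_op L) (dualR L)
    (@dualR_scaleA L) (@dualR_map1 L) (@dualR_scaleDr L) (@dualR_scaleDl L).
End DualRight.

(** * Triangulated categories *)

Record additive_category : Type := AdditiveCategory {
  additive_cat :> preadditive;
  zero_obj : additive_cat;
  zero_objP : zero_object zero_obj;
  biproduct_ex : forall X Y : additive_cat,
    exists S (i : hom X S) (j : hom Y S) (p : hom S X) (q : hom S Y),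
      is_biproduct i j p q
}.

(* The translation is an additive autoequivalence; [exact_triangle f g h]
   says that the triangle X -f-> Y -g-> Z -h-> X[1] is exact. *)
Record triangulated : Type := Triangulated {
  triangulated_cat :> additive_category;
  shift : triangulated_cat -> triangulated_cat;
  shiftm : forall X Y : triangulated_cat,
    hom X Y -> hom (shift X) (shift Y);
  shiftmD : forall (X Y : triangulated_cat) (f g : hom X Y),
    shiftm (f + g) = shiftm f + shiftm g;
  shiftm1 : forall X : triangulated_cat, shiftm (idm X) = idm (shift X);
  shiftmM : forall (X Y Z : triangulated_cat) (g : hom Y Z) (f : hom X Y),
    shiftm (g \co f) = shiftm g \co shiftm f;
  shiftm_bij : forall X Y : triangulated_cat, bijective (@shiftm X Y);
  shift_ess_surj : forall Y : triangulated_cat,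
    exists X (f : hom (shift X) Y), isomorphism f;
  exact_triangle : forall X Y Z : triangulated_cat,
    hom X Y -> hom Y Z -> hom Z (shift X) -> Prop;
  exact_iso : forall (X Y Z X' Y' Z' : triangulated_cat)
    (f : hom X Y) (g : hom Y Z) (h : hom Z (shift X))
    (f' : hom X' Y') (g' : hom Y' Z') (h' : hom Z' (shift X'))
    (u : hom X X') (v : hom Y Y') (w : hom Z Z'),
    isomorphism u -> isomorphism v -> isomorphism w ->
    v \co f = f' \co u -> w \co g = g' \co v ->
    shiftm u \co h = h' \co w ->
    exact_triangle f g h -> exact_triangle f' g' h';
  exact_id : forall X : triangulated_cat,
    exact_triangle (idm X) (0 : hom X (zero_obj triangulated_cat)) 0;
  exact_cone : forall (X Y : triangulated_cat) (f : hom X Y),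
    exists Z (g : hom Y Z) (h : hom Z (shift X)), exact_triangle f g h;
  exact_rotate : forall (X Y Z : triangulated_cat)
    (f : hom X Y) (g : hom Y Z) (h : hom Z (shift X)),
    exact_triangle f g h <-> exact_triangle g h (- shiftm f);
  exact_morphism : forall (X Y Z X' Y' Z' : triangulated_cat)
    (f : hom X Y) (g : hom Y Z) (h : hom Z (shift X))
    (f' : hom X' Y') (g' : hom Y' Z') (h' : hom Z' (shift X'))
    (u : hom X X') (v : hom Y Y'),
    exact_triangle f g h -> exact_triangle f' g' h' ->
    v \co f = f' \co u ->
    exists w : hom Z Z', w \co g = g' \co v /\ shiftm u \co h = h' \co w;
  exact_octahedron : forall (X Y Z X' Y' Z' : triangulated_cat)
    (f : hom X Y) (g : hom Y Z)
    (f1 : hom Y Z') (f2 : hom Z' (shift X))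
    (g1 : hom Z X') (g2 : hom X' (shift Y))
    (h1 : hom Z Y') (h2 : hom Y' (shift X)),
    exact_triangle f f1 f2 -> exact_triangle g g1 g2 ->
    exact_triangle (g \co f) h1 h2 ->
    exists (a : hom Z' Y') (b : hom Y' X'),
      [/\ exact_triangle a b (shiftm f1 \co g2),
          a \co f1 = h1 \co g, h2 \co a = f2,
          b \co h1 = g1 & g2 \co b = shiftm f \co h2]
}.

Lemma shiftm_zmod (A : triangulated) (X Y : A) :
  zmod_morphism (@shiftm A X Y).
Proof.
move=> f g; apply: (addIr (shiftm g)).
by rewrite subrK -shiftmD subrK.
Qed.

HB.instance Definition _ (A : triangulated) (X Y : A) :=
  GRing.isZmodMorphism.Build _ _ (@shiftm A X Y) (@shiftm_zmod A X Y).

(** * Tri-exact categories *)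

Record tri_exact : Type := TriExact {
  ambient : triangulated;
  tri_mem : ambient -> Prop;
  tri_mem_zero : tri_mem (zero_obj ambient);
  tri_mem_extension : forall (X Y Z : ambient)
    (f : hom X Y) (g : hom Y Z) (h : hom Z (shift X)),
    exact_triangle f g h -> tri_mem X -> tri_mem Z -> tri_mem Y
}.

Definition tri_exact_cat (C : tri_exact) : preadditive :=
  full_subcategory (@tri_mem C).

Coercion tri_exact_cat : tri_exact >-> preadditive.

Section TriExact.
Variable C : tri_exact.
Implicit Types L M N X Y Z : C.

(* the object X of C, in the ambient triangulated category *)
Definition amb X : ambient C := sval X.

(* Ext^1_C(X, Y) *)
Definition ext X Y : Type := hom (amb X) (shift (amb Y)).

HB.instance Definition _ X Y :=
  GRing.Zmodule.copy (ext X Y) (hom (amb X) (shift (amb Y))).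

Definition ext_push X Y N (g : hom Y N) (d : ext X Y) : ext X N :=
  shiftm (g : hom (amb Y) (amb N)) \co d.

Definition ext_pull X Y M (f : hom M X) (d : ext X Y) : ext M Y :=
  d \co (f : hom (amb M) (amb X)).

Definition defines_sequence X Y Z (f : hom X Y) (g : hom Y Z) (d : ext Z X) :
    Prop :=
  exact_triangle (f : hom (amb X) (amb Y)) (g : hom (amb Y) (amb Z)) d.

Definition tri_exact_sequence X Y Z (f : hom X Y) (g : hom Y Z) : Prop :=
  exists d : ext Z X, defines_sequence f g d.

Definition almost_split_sequence X Y Z (f : hom X Y) (g : hom Y Z) : Prop :=
  [/\ tri_exact_sequence f g, minimal_left_almost_split f
    & minimal_right_almost_split g].

Definition injectively_trivial X Y (f : hom X Y) : Prop :=
  forall M (d : ext M X), ext_push f d = 0.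

Definition projectively_trivial X Y (f : hom X Y) : Prop :=
  forall M (d : ext Y M), ext_pull f d = 0.

Fact ext_push_zmod X Y N (g : hom Y N) : zmod_morphism (@ext_push X Y N g).
Proof. exact: comp_zmod_morphismr. Qed.
Fact ext_pull_zmod X Y M (f : hom M X) : zmod_morphism (@ext_pull X Y M f).
Proof. exact: comp_zmod_morphisml. Qed.

HB.instance Definition _ X Y N g :=
  GRing.isZmodMorphism.Build _ _ (@ext_push X Y N g) (@ext_push_zmod X Y N g).
HB.instance Definition _ X Y M f :=
  GRing.isZmodMorphism.Build _ _ (@ext_pull X Y M f) (@ext_pull_zmod X Y M f).

Lemma ext_push1 X Y (d : ext X Y) : ext_push (idm Y) d = d.
Proof. by rewrite /ext_push shiftm1 comp1m. Qed.
Lemma ext_pushM X Y N N' (g' : hom N N') (g : hom Y N) (d : ext X Y) :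
  ext_push (g' \co g) d = ext_push g' (ext_push g d).
Proof. by rewrite /ext_push shiftmM compA. Qed.
Lemma ext_pushD X Y N (g g' : hom Y N) (d : ext X Y) :
  ext_push (g + g') d = ext_push g d + ext_push g' d.
Proof. by rewrite /ext_push shiftmD compDl. Qed.
Lemma ext_pushB X Y N (g g' : hom Y N) (d : ext X Y) :
  ext_push (g - g') d = ext_push g d - ext_push g' d.
Proof. by apply: (addIr (ext_push g' d)); rewrite subrK -ext_pushD subrK. Qed.

Lemma ext_pull1 X Y (d : ext X Y) : ext_pull (idm X) d = d.
Proof. exact: compm1. Qed.
Lemma ext_pullM X Y M M' (f : hom M X) (f' : hom M' M) (d : ext X Y) :
  ext_pull (f \co f') d = ext_pull f' (ext_pull f d).
Proof. exact: compA. Qed.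
Lemma ext_pullD X Y M (f f' : hom M X) (d : ext X Y) :
  ext_pull (f + f') d = ext_pull f d + ext_pull f' d.
Proof. exact: compDr. Qed.
Lemma ext_pullB X Y M (f f' : hom M X) (d : ext X Y) :
  ext_pull (f - f') d = ext_pull f d - ext_pull f' d.
Proof. by apply: (addIr (ext_pull f' d)); rewrite subrK -ext_pullD subrK. Qed.

Definition inj_ideal : hom_ideal C.
Proof.
refine (@HomIdeal C injectively_trivial _ _ _ _).
- by move=> X Y M d; rewrite -(subrr 0) ext_pushB subrr.
- by move=> X Y f g f0 g0 M d; rewrite ext_pushB f0 g0 subrr.
- by move=> X Y Z g f f0 M d; rewrite ext_pushM f0 raddf0.
- by move=> X Y Z g f g0 M d; rewrite ext_pushM g0.
Defined.

Definition proj_ideal : hom_ideal C.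
Proof.
refine (@HomIdeal C projectively_trivial _ _ _ _).
- by move=> X Y M d; rewrite -(subrr 0) ext_pullB subrr.
- by move=> X Y f g f0 g0 M d; rewrite ext_pullB f0 g0 subrr.
- by move=> X Y Z g f f0 M d; rewrite ext_pullM f0.
- by move=> X Y Z g f g0 M d; rewrite ext_pullM g0 raddf0.
Defined.

(* Ext^1_C(Z, -) and Ext^1_C(-, X) *)
Definition ext_covariant Z : abfunctor C :=
  @AbFunctor C (ext Z) (fun X Y g => @ext_push Z X Y g)
    (fun X Y => @ext_pushD Z X Y) (@ext_push1 Z)
    (fun X Y N => @ext_pushM Z X Y N).

Definition ext_contravariant X : abfunctor (opposite C) :=
  @AbFunctor (opposite C) (fun Z => ext Z X)
    (fun Z M (f : @hom C M Z) => @ext_pull Z X M f)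
    (fun Z M => @ext_pullD Z X M) (fun Z => @ext_pull1 Z X)
    (fun Z M M' f' f => @ext_pullM Z X M M' f f').

End TriExact.

(* C modulo the injectively, resp. projectively, trivial morphisms *)
Notation inj_stable C := (quotient_category (inj_ideal C)).
Notation proj_stable C := (quotient_category (proj_ideal C)).

(* The bimodule Ext^1_C(Z, X): [extL Z X] carries its structure of left
   module over the injectively stable endomorphism ring of X, and [extR Z X]
   that of right module over the projectively stable one of Z. *)
Section ExtModules.
Variable C : tri_exact.
Implicit Types X Z : C.

Definition extL Z X : Type := ext Z X.

HB.instance Definition _ Z X := GRing.Zmodule.copy (extL Z X) (ext Z X).

Definition extL_scale Z X (a : endo (X : inj_stable C)) (d : extL Z X) :
    extL Z X :=
  ext_push (repr (a : qhom (inj_ideal C) X X)) d.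

Lemma extL_scaleE Z X (f : hom X X) (d : extL Z X) :
  extL_scale (proj (inj_ideal C) f) d = ext_push f d.
Proof.
apply/eqP; rewrite -subr_eq0; apply/eqP.
rewrite /extL_scale -[LHS]ext_pushB.
have /projP h : proj (inj_ideal C) (repr (proj (inj_ideal C) f)) =
  proj (inj_ideal C) f by rewrite projK.
exact: (h Z d).
Qed.

Fact extL_scaleA Z X a b (d : extL Z X) :
  extL_scale a (extL_scale b d) = extL_scale (a * b) d.
Proof.
by rewrite [RHS]extL_scaleE ext_pushM.
Qed.
Fact extL_scale1 Z X : left_id 1 (@extL_scale Z X).
Proof. by move=> d; rewrite -[RHS]ext_push1 -extL_scaleE. Qed.
Fact extL_scaleDr Z X : right_distributive (@extL_scale Z X) +%R.
Proof. by move=> a d e; exact: raddfD. Qed.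
Fact extL_scaleDl Z X (d : extL Z X) :
  {morph (@extL_scale Z X)^~ d : a b / a + b}.
Proof.
move=> a b /=.
have <- := projK (a : qhom (inj_ideal C) X X).
have <- := projK (b : qhom (inj_ideal C) X X).
rewrite [X in extL_scale X](_ : _ =
  proj (inj_ideal C) (repr (a : qhom (inj_ideal C) X X) +
                      repr (b : qhom (inj_ideal C) X X))); last first.
  by rewrite raddfD.
by rewrite !extL_scaleE -[RHS]ext_pushD.
Qed.

HB.instance Definition _ Z X := GRing.Zmodule_isLmodule.Build
  (endo (X : inj_stable C)) (extL Z X)
  (@extL_scaleA Z X) (@extL_scale1 Z X) (@extL_scaleDr Z X)
  (@extL_scaleDl Z X).

Definition extR Z X : Type := ext Z X.

HB.instance Definition _ Z X := GRing.Zmodule.copy (extR Z X) (ext Z X).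

Definition extR_scale Z X (a : endo_op (Z : proj_stable C)) (d : extR Z X) :
    extR Z X :=
  ext_pull (repr (a : qhom (proj_ideal C) Z Z)) d.

Lemma extR_scaleE Z X (f : hom Z Z) (d : extR Z X) :
  extR_scale (proj (proj_ideal C) f) d = ext_pull f d.
Proof.
apply/eqP; rewrite -subr_eq0; apply/eqP.
rewrite /extR_scale -[LHS]ext_pullB.
have /projP h : proj (proj_ideal C) (repr (proj (proj_ideal C) f)) =
  proj (proj_ideal C) f by rewrite projK.
exact: (h X d).
Qed.

Fact extR_scaleA Z X a b (d : extR Z X) :
  extR_scale a (extR_scale b d) = extR_scale (a * b) d.
Proof.
by rewrite [RHS]extR_scaleE ext_pullM.
Qed.
Fact extR_scale1 Z X : left_id 1 (@extR_scale Z X).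
Proof. by move=> d; rewrite -[RHS]ext_pull1 -extR_scaleE. Qed.
Fact extR_scaleDr Z X : right_distributive (@extR_scale Z X) +%R.
Proof. by move=> a d e; exact: raddfD. Qed.
Fact extR_scaleDl Z X (d : extR Z X) :
  {morph (@extR_scale Z X)^~ d : a b / a + b}.
Proof.
move=> a b /=.
have <- := projK (a : qhom (proj_ideal C) Z Z).
have <- := projK (b : qhom (proj_ideal C) Z Z).
rewrite [X in extR_scale X](_ : _ =
  proj (proj_ideal C) (repr (a : qhom (proj_ideal C) Z Z) +
                       repr (b : qhom (proj_ideal C) Z Z))); last first.
  by rewrite raddfD.
by rewrite !extR_scaleE -[RHS]ext_pullD.
Qed.

HB.instance Definition _ Z X := GRing.Zmodule_isLmodule.Build
  (endo_op (Z : proj_stable C)) (extR Z X)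
  (@extR_scaleA Z X) (@extR_scale1 Z X) (@extR_scaleDr Z X)
  (@extR_scaleDl Z X).

End ExtModules.

(** * The maps Psi_X and Phi_Z *)

Section PsiX.
Variables (C : tri_exact) (X Z : C) (R : pzRingType).
Variables (phi : {rmorphism R -> endo (X : inj_stable C)}) (I : lmodType R).
Variable Psi : nattrans (ext_covariant Z) (dualL_functor phi I).

Definition left_component : extL Z X -> dualL phi I X := Psi X.

Fact left_component_zmod : zmod_morphism left_component.
Proof. exact: raddfB. Qed.

Fact left_component_scalable :
  scalable (left_component : extL Z X -> dualL phi I (X : inj_stable C)).
Proof.
move=> a d; have <- := projK (a : qhom (inj_ideal C) X X).
rewrite [LHS](_ : _ = Psi X (ext_push (repr (a : qhom (inj_ideal C) X X)) d)).
  exact: (naturality Psi).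
by congr (Psi X _); exact: extL_scaleE.
Qed.

HB.instance Definition _ :=
  GRing.isZmodMorphism.Build _ _ left_component left_component_zmod.
HB.instance Definition _ :=
  GRing.isScalable.Build _ _ _ _ left_component left_component_scalable.
End PsiX.

Section PhiZ.
Variables (C : tri_exact) (X Z : C) (R : pzRingType).
Variables (psi : {rmorphism R -> endo_op (Z : proj_stable C)}) (I : lmodType R).
Variable Phi : nattrans (ext_contravariant X) (dualR_functor psi I).

Definition right_component : extR Z X -> dualR psi I Z := Phi Z.

Fact right_component_zmod : zmod_morphism right_component.
Proof. exact: raddfB. Qed.

Fact right_component_scalable :
  scalable (right_component : extR Z X -> dualR psi I (Z : proj_stable C)).
Proof.
move=> a d; have <- := projK (a : qhom (proj_ideal C) Z Z).
rewrite [LHS](_ : _ = Phi Z (ext_pull (repr (a : qhom (proj_ideal C) Z Z)) d)).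
  exact: (naturality Phi).
by congr (Phi Z _); exact: extR_scaleE.
Qed.

HB.instance Definition _ :=
  GRing.isZmodMorphism.Build _ _ right_component right_component_zmod.
HB.instance Definition _ :=
  GRing.isScalable.Build _ _ _ _ right_component right_component_scalable.
End PhiZ.

(* Main.v *)
From HB Require Import structures.
Require Import Defs.
From mathcomp Require Import all_boot ssralg boolp functions.
(* [all_boot] shadows [Defs.compA]. *)
Import Defs.
Set Implicit Arguments.
Unset Strict Implicit.
Unset Printing Implicit Defensive.
Import GRing.Theory.
Local Open Scope ring_scope.

(**
An almost split sequence X -> Y -> Z is the same thing as a nonzero class d in
Ext^1(Z, X) with u.d = 0 for every non-section u : X -> M, and also the same
thing as a nonzero d with d.w = 0 for every non-retraction w : M -> Z.  These
two conditions agree because a nonzero e in Ext^1(M, X) sits in a triangle whose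
first map is not a section, hence kills d, so that d factors as e.w.

Given such a d, the End(X)-submodule it generates is isomorphic to S_X, so
injectivity of I extends a Gamma-linear map S_X -> I to chi : Ext^1(Z, X) -> I
with chi(d) <> 0, and Psi(z)(u) = chi(u.z) works: if z <> 0 then d = u.z for
some u, and Psi(d) lies in the socle because the radical of End(X) kills d.

Conversely the dual of End(X) modulo injectively trivial maps has nonzero socle,
since it contains the map induced by a nonzero S_X -> I.  If Psi(d) is in the
socle and nonzero then the radical kills d, and naturality propagates this to
u.d = 0 for all non-sections u.  The case of Phi is dual.
*)

(** * Preadditive categories: zero objects and automorphisms of the form 1 + t g *)

Section PreadditiveTheory.
Variable C : preadditive.
Implicit Types X Y Z : C.

Lemma compmN X Y Z (g : hom Y Z) (f : hom X Y) : g \co (- f) = - (g \co f).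
Proof. by rewrite -sub0r compBr compm0 sub0r. Qed.

Lemma compNm X Y Z (g : hom Y Z) (f : hom X Y) : (- g) \co f = - (g \co f).
Proof. by rewrite -sub0r compBl comp0m sub0r. Qed.

Lemma zero_object_isomorphism (O O' : C) (f : hom O O') :
  zero_object O -> zero_object O' -> isomorphism f.
Proof.
move=> zO zO'; exists 0; split; rewrite ?compm0 ?comp0m; symmetry.
  exact: (zO O).1.
exact: (zO' O').1.
Qed.

Lemma isomorphism_idm X : isomorphism (idm X).
Proof. by exists (idm X); rewrite comp1m. Qed.

(* The inverse is [1 - t (1 + g t)^-1 g]. *)
Lemma isomorphism_swap Y Z (g : hom Y Z) (t : hom Z Y) :
  isomorphism (idm Z + g \co t) -> isomorphism (idm Y + t \co g).
Proof.
case=> w; rewrite compDl compDr comp1m compm1 => -[lw rw].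
exists (idm Y - t \co w \co g); split.
- have /= := congr1 (fun v => t \co v \co g) lw.
  rewrite compDr compDl. rewrite !compA compm1 => tg.
  by rewrite compDr compm1 compBl comp1m !compA -{1}tg addrK subrK.
- have /= := congr1 (fun v => t \co v \co g) rw.
  rewrite compDr compDl. rewrite !compA compm1 => tg.
  by rewrite compDl comp1m compBr compm1 !compA -{1}tg addrK subrK.
Qed.

End PreadditiveTheory.

(** * Exactness properties of triangles *)

Section Triangles.
Variable A : triangulated.
Implicit Types W X Y Z : A.

Lemma shiftm_inj X Y : injective (@shiftm A X Y).
Proof. exact: bij_inj (shiftm_bij X Y). Qed.

Lemma shiftm_surj X Y (f : hom (shift X) (shift Y)) :
  exists g : hom X Y, f = shiftm g.
Proof. by have [k _ kK] := shiftm_bij X Y; exists (k f); rewrite kK. Qed.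

Lemma shift_zero_object (O : A) : zero_object O -> zero_object (shift O).
Proof.
move=> zO; have id0 : idm (shift O) = 0.
  by rewrite -shiftm1 [idm O](zO O).1 raddf0.
by move=> X; split=> f; [rewrite -[f]comp1m | rewrite -[f]compm1];
  rewrite id0 ?comp0m ?compm0.
Qed.

(** One rotation turns this into the triangle of [idm W], up to replacing the zero object by its
    shift, which is again a zero object. *)
Lemma exact_zero_id W :
  exact_triangle (0 : hom (zero_obj A) W) (idm W) 0.
Proof.
apply/exact_rotate; rewrite raddf0 oppr0.
have z0 := @zero_objP A; have z1 := shift_zero_object z0.
apply: (exact_iso (u := idm W) (v := idm W) (w := 0) _ _ _ _ _ _ (exact_id W)).
- exact: isomorphism_idm.
- exact: isomorphism_idm.
- exact: zero_object_isomorphism.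
- by [].
- by rewrite !comp0m.
- by rewrite !comp0m compm0.
Qed.

Section Exact.
Variables (X Y Z : A) (f : hom X Y) (g : hom Y Z) (h : hom Z (shift X)).
Hypothesis ex : exact_triangle f g h.

(** Comparison with the triangle of [idm X] makes [g \co f] factor through the zero object. *)
Lemma exact_comp0 : g \co f = 0.
Proof.
have [w [wE _]] := exact_morphism (u := idm X) (v := f)
  (exact_id X) ex (erefl _).
by rewrite -wE compm0.
Qed.

(** [u] is part of a map of triangles into 0 -> W -> W, whose third component is [t]. *)
Lemma exact_weak_cokernel W (u : hom Y W) :
  u \co f = 0 -> exists t : hom Z W, u = t \co g.
Proof.
move=> uf; have uf' : u \co f = 0 \co (0 : hom X (zero_obj A)).
  by rewrite uf compm0.
have [t [tE _]] := exact_morphism ex (exact_zero_id W) uf'.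
by exists t; rewrite tE comp1m.
Qed.

Lemma exact_weak_kernel W (u : hom W Y) :
  g \co u = 0 -> exists s : hom W X, u = f \co s.
Proof.
move=> gu; have /exact_rotate exW := exact_id W; have /exact_rotate exg := ex.
have gu' : 0 \co (0 : hom W (zero_obj A)) = g \co u by rewrite gu compm0.
have [w [_]] := exact_morphism exW exg gu'.
have [s ->] := shiftm_surj w; rewrite compNm compmN => /oppr_inj.
by rewrite -!shiftmM compm1 => /shiftm_inj; exists s.
Qed.

End Exact.

Section ExactRotations.
Variables (X Y Z : A) (f : hom X Y) (g : hom Y Z) (h : hom Z (shift X)).
Hypothesis ex : exact_triangle f g h.
Let ex1 : exact_triangle g h (- shiftm f) := (exact_rotate f g h).1 ex.
Let ex2 := (exact_rotate g h (- shiftm f)).1 ex1.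

Lemma exact_connecting_comp : h \co g = 0.
Proof. exact: exact_comp0 ex1. Qed.

Lemma exact_shift_connecting : shiftm f \co h = 0.
Proof. by apply/eqP; rewrite -oppr_eq0 -compNm (exact_comp0 ex2). Qed.

Lemma exact_lift_deflation W (w : hom W Z) :
  h \co w = 0 -> exists v : hom W Y, w = g \co v.
Proof. exact: (exact_weak_kernel ex1). Qed.

Lemma exact_lift_connecting W (d : hom W (shift X)) :
  shiftm f \co d = 0 -> exists w : hom W Z, d = h \co w.
Proof.
by move=> fd; apply: (exact_weak_kernel ex2); rewrite compNm fd oppr0.
Qed.

Lemma exact_extend_connecting W (d : hom Z W) :
  d \co g = 0 -> exists m : hom (shift X) W, d = m \co h.
Proof. exact: (exact_weak_cokernel ex1). Qed.

Lemma exact_extend_inflation W (u : hom X W) :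
  shiftm u \co h = 0 -> exists v : hom Y W, u = v \co f.
Proof.
move=> /(exact_weak_cokernel ex2) [t]; have [v ->] := shiftm_surj t.
rewrite compmN -compNm -raddfN -shiftmM => /shiftm_inj ->.
by exists (- v).
Qed.

End ExactRotations.

(** The cone W of [h] is isomorphic to some Y[1], and rotating back twice puts Y in the middle. *)
Lemma exact_fiber X Z (h : hom Z (shift X)) :
  exists Y (f : hom X Y) (g : hom Y Z), exact_triangle f g h.
Proof.
have [W [k [l ex]]] := exact_cone h.
have [Y [p [q [qp pq]]]] := shift_ess_surj W.
have [f fE] := shiftm_surj (q \co k); have [g gE] := shiftm_surj (l \co p).
(* These signs cancel the ones that the two rotations introduce. *)
exists Y, (- f), (- g); apply/exact_rotate/exact_rotate.
rewrite !(raddfN (@shiftm A _ _)) /= !opprK -fE -gE.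
apply: (exact_iso (u := idm Z) (v := idm _) (w := q) _ _ _ _ _ _ ex).
- exact: isomorphism_idm.
- exact: isomorphism_idm.
- by exists p.
- by rewrite compm1 comp1m.
- by rewrite compm1.
- by rewrite shiftm1 comp1m -compA pq compm1.
Qed.

End Triangles.

(** * Almost split sequences as classes in Ext *)

Section Sequences.
Variable C : tri_exact.
Implicit Types L M N W X Y Z : C.

(** The middle term lies in the category by closure under extensions. *)
Lemma defines_sequence_ex X Z (d : ext Z X) :
  exists Y (f : hom X Y) (g : hom Y Z), defines_sequence f g d.
Proof.
have [Y [f [g ex]]] := exact_fiber d.
have CY := tri_mem_extension ex (svalP X) (svalP Z).
by exists (exist _ Y CY), f, g.
Qed.

(** * Exactness of Ext along one tri-exact sequence *)

Section Sequence.
Variables (X Y Z : C) (f : hom X Y) (g : hom Y Z) (d : ext Z X).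
Hypothesis fgd : defines_sequence f g d.

Lemma ext_push_inflation : ext_push f d = 0.
Proof. exact: exact_shift_connecting fgd. Qed.

Lemma ext_pull_deflation : ext_pull g d = 0.
Proof. exact: exact_connecting_comp fgd. Qed.

Lemma inflation_extend M (u : hom X M) :
  ext_push u d = 0 -> exists v : hom Y M, u = v \co f.
Proof. exact: (exact_extend_inflation fgd). Qed.

Lemma deflation_lift M (w : hom M Z) :
  ext_pull w d = 0 -> exists v : hom M Y, w = g \co v.
Proof. exact: (exact_lift_deflation fgd). Qed.

Lemma ext_push_inflation_eq0 M (e : ext M X) :
  ext_push f e = 0 -> exists w : hom M Z, e = ext_pull w d.
Proof. exact: (exact_lift_connecting fgd). Qed.

Lemma ext_pull_deflation_eq0 M (e : ext Z M) :
  ext_pull g e = 0 -> exists m : hom X M, e = ext_push m d.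
Proof.
case/(exact_extend_connecting fgd)=> k; have [m ->] := shiftm_surj k.
by move=> ->; exists m.
Qed.

Lemma inflation_cokernel M (u : hom Y M) :
  u \co f = 0 -> exists t : hom Z M, u = t \co g.
Proof. exact: (exact_weak_cokernel fgd). Qed.

Lemma deflation_kernel M (u : hom M Y) :
  g \co u = 0 -> exists s : hom M X, u = f \co s.
Proof. exact: (exact_weak_kernel fgd). Qed.

(** The obstruction to extending [idm X] along [f] is [d] itself. *)
Lemma inflation_sectionP : is_section f <-> d = 0.
Proof.
split=> [[r rf]|d0]; last first.
  have [|v fv] := @inflation_extend _ (idm X).
    by rewrite d0 raddf0.
  by exists v.
by rewrite -[d]ext_push1 -rf ext_pushM ext_push_inflation raddf0.
Qed.

Lemma deflation_retractionP : is_retraction g <-> d = 0.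
Proof.
split=> [[s gs]|d0]; last first.
  have [|v fv] := @deflation_lift _ (idm Z).
    by rewrite d0 raddf0.
  by exists v.
by rewrite -[d]ext_pull1 -gs ext_pullM ext_pull_deflation raddf0.
Qed.

End Sequence.

Definition kills_nonsections Z X (d : ext Z X) : Prop :=
  forall M (u : hom X M), ~ is_section u -> ext_push u d = 0.

Definition kills_nonretractions Z X (d : ext Z X) : Prop :=
  forall M (w : hom M Z), ~ is_retraction w -> ext_pull w d = 0.

(** If [a] were not a unit, [1 - a] would be one, yet it kills [d]. *)
Lemma ext_push_fixed X Z (d : ext Z X) (a : endo X) :
  strongly_indecomposable X -> d <> 0 -> ext_push a d = d -> invertible a.
Proof.
move=> locX nz ad; apply: contrapT => /(local_compl locX) [b [_ b1]].
apply: nz; rewrite -[d]ext_push1 [idm X](_ : _ = b * (1 - a)); last by [].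
by rewrite ext_pushM ext_pushB ext_push1 ad subrr raddf0.
Qed.

Lemma ext_pull_fixed X Z (d : ext Z X) (a : endo Z) :
  strongly_indecomposable Z -> d <> 0 -> ext_pull a d = d -> invertible a.
Proof.
move=> locZ nz ad; apply: contrapT => /(local_compl locZ) [b [b1 _]].
apply: nz; rewrite -[d]ext_pull1 [idm Z](_ : _ = (1 - a) * b); last by [].
by rewrite ext_pullM ext_pullB ext_pull1 ad subrr raddf0.
Qed.

(** In other words, [d] lies in every nonzero subfunctor of Ext^1(-, X). This later makes
    [dualR_nattrans] injective. *)
Lemma kills_nonsections_factor X Z M (d : ext Z X) (e : ext M X) :
  kills_nonsections d -> e <> 0 -> exists w : hom Z M, d = ext_pull w e.
Proof.
move=> kd nz; have [Y [f [g fge]]] := defines_sequence_ex e.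
apply: (ext_push_inflation_eq0 fge); apply: kd.
by move/(inflation_sectionP fge).
Qed.

Lemma kills_nonretractions_factor X Z M (d : ext Z X) (e : ext Z M) :
  kills_nonretractions d -> e <> 0 -> exists u : hom M X, d = ext_push u e.
Proof.
move=> kd nz; have [Y [f [g fge]]] := defines_sequence_ex e.
apply: (ext_pull_deflation_eq0 fge); apply: kd.
by move/(deflation_retractionP fge).
Qed.

Section AlmostSplit.
Variables X Z : C.
Hypothesis locX : strongly_indecomposable X.
Hypothesis locZ : strongly_indecomposable Z.

(** If [ext_pull w d] were nonzero, [d] would be its pullback along some [w']; then [w \co w'] fixes
    [d], hence is invertible, and [w] is a retraction. *)
Lemma kills_nonsections_nonretractions (d : ext Z X) :
  d <> 0 -> kills_nonsections d -> kills_nonretractions d.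
Proof.
move=> nz kd M w nw; apply: contrapT => nzw; apply: nw.
have [w' dE] := kills_nonsections_factor kd nzw.
have [|b [b1 _]] := ext_pull_fixed (a := w \co w') locZ nz.
  by rewrite ext_pullM.
by exists (w' \co (b : hom Z Z)); rewrite compA.
Qed.

Lemma kills_nonretractions_nonsections (d : ext Z X) :
  d <> 0 -> kills_nonretractions d -> kills_nonsections d.
Proof.
move=> nz kd M u nu; apply: contrapT => nzu; apply: nu.
have [u' dE] := kills_nonretractions_factor kd nzu.
have [|b [_ b1]] := ext_push_fixed (a := u' \co u) locX nz.
  by rewrite ext_pushM.
by exists ((b : hom X X) \co u'); rewrite -compA.
Qed.

Lemma almost_split_sequence_kills Y (f : hom X Y) (g : hom Y Z) (d : ext Z X) :
  d <> 0 -> kills_nonsections d -> defines_sequence f g d ->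
  almost_split_sequence f g.
Proof.
move=> nz kL fgd; have kR := kills_nonsections_nonretractions nz kL.
split; first by exists d.
- split; last split; last 1 first.
  + by move=> M u /kL /(inflation_extend fgd).
  (* Here h = 1 + t g, and 1 + g t fixes [d] because [g] pulls [d] back to 0. So 1 + g t is
     invertible, and [isomorphism_swap] carries this over to [h]. *)
  + move=> h hf; have [|t tE] := inflation_cokernel fgd (u := h - idm Y).
      by rewrite compBl hf comp1m subrr.
    rewrite (_ : h = idm Y + t \co g); last by rewrite -tE addrC subrK.
    apply: isomorphism_swap.
    have [|b [b1 b2]] := ext_pull_fixed (a := idm Z + g \co t) locZ nz.
      by rewrite ext_pullD ext_pull1 ext_pullM (ext_pull_deflation fgd) raddf0
        addr0.
    by exists b.
  + by move/(inflation_sectionP fgd).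
- split; last split; last 1 first.
  + by move=> M u /kR /(deflation_lift fgd).
  + move=> h hf; have [|t tE] := deflation_kernel fgd (u := h - idm Y).
      by rewrite compBr hf compm1 subrr.
    rewrite (_ : h = idm Y + f \co t); last by rewrite -tE addrC subrK.
    apply: isomorphism_swap.
    have [|b [b1 b2]] := ext_push_fixed (a := idm X + t \co f) locX nz.
      by rewrite ext_pushD ext_push1 ext_pushM (ext_push_inflation fgd) raddf0
        addr0.
    by exists b.
  + by move/(deflation_retractionP fgd).
Qed.

Lemma almost_split_sequence_exP :
  (exists (Y : C) (f : hom X Y) (g : hom Y Z), almost_split_sequence f g) <->
  exists d : ext Z X, [/\ d <> 0, kills_nonsections d & kills_nonretractions d].
Proof.
split=> [[Y [f [g [[d fgd] [_ [nf lf]] [_ [ng rg]]]]]]|[d [nz kL _]]].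
  exists d; split.
  - by move/(inflation_sectionP fgd).
  - move=> M u /lf [v ->].
    by rewrite ext_pushM (ext_push_inflation fgd) raddf0.
  - move=> M u /rg [v ->].
    by rewrite ext_pullM (ext_pull_deflation fgd) raddf0.
have [Y [f [g fgd]]] := defines_sequence_ex d.
by exists Y, f, g; apply: almost_split_sequence_kills fgd.
Qed.

End AlmostSplit.
End Sequences.

(** * Socles over local rings *)

Lemma linear_ex (R : pzRingType) (M N : lmodType R) (f : M -> N) :
  linear f -> exists g : {linear M -> N}, forall x, g x = f x.
Proof.
move=> lf.
pose g : {linear M -> N} := HB.pack f (GRing.isLinear.Build R M N _ f lf).
by exists g.
Qed.

(** Some coordinate of the embedding into a power of [I] is nonzero at [s]. *)
Lemma injective_cogenerator_separates (R : pzRingType) (S I : lmodType R)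
    (s : S) :
  injective_cogenerator S I -> s <> 0 ->
  exists chi : {linear S -> I}, chi s <> 0.
Proof.
move=> [_ [T [e e_inj]]] nz.
have [t et] : exists t, e s t <> 0.
  apply: contrapT => /forallNP h; apply: nz; apply: e_inj; rewrite raddf0.
  by apply: funext => t; have := h t; rewrite notK.
have [|chi chiE] := @linear_ex R S I (fun x => e x t).
  by move=> a x y; rewrite linearP.
by exists chi; rewrite chiE.
Qed.

Section LocalModules.
Variable R : pzRingType.
Hypothesis locR : local_ring R.
Variable N : lmodType R.

(** A Nakayama argument: the submodule generated by [r *: x] is zero or all of [U]; in the second
    case x = a r x with 1 - a r invertible, so x = 0. *)
Lemma simple_submodule_annihilated (U : N -> Prop) x r :
  simple_submodule U -> U x -> ~ invertible r -> r *: x = 0.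
Proof.
move=> [[U0 UD UZ] _ Umin] Ux nr.
case: (Umin (fun y => exists a, y = a *: (r *: x))) => [||h|/(_ x Ux) [a xE]].
- split; first by exists 0; rewrite scale0r.
    by move=> _ _ [a ->] [b ->]; exists (a + b); rewrite scalerDl.
  by move=> b _ [a ->]; exists (b * a); rewrite scalerA.
- by move=> _ [a ->]; apply/UZ/UZ.
- by apply: h; exists 1; rewrite scale1r.
have [b [_ b1]] := local_compl locR (local_nonunitMl locR (r := a) nr).
have : (1 - a * r) *: x = 0 by rewrite scalerBl scale1r -scalerA -xE subrr.
move=> /(congr1 ( *:%R b)); rewrite scalerA b1 scale1r scaler0 => ->.
by rewrite scaler0.
Qed.

Lemma socle_annihilated (x : N) r : socle x -> ~ invertible r -> r *: x = 0.
Proof.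
move=> [n [s [ss ->]]] nr; rewrite scaler_sumr big1 // => i _.
by have [U [sU Us]] := ss i; exact: (simple_submodule_annihilated sU Us nr).
Qed.

(** The cyclic module R x is simple: [a *: x] is nonzero only for invertible [a], and then it
    generates [x]. So [x] is a sum with a single term. *)
Lemma annihilated_socle (x : N) :
  x <> 0 -> (forall r, ~ invertible r -> r *: x = 0) -> socle x.
Proof.
move=> nz rx; exists 1%N, (fun=> x); split; last by rewrite big_ord1.
move=> _; exists (fun y => exists a, y = a *: x); split; last first.
  by exists 1; rewrite scale1r.
split; last 1 first.
- move=> V [_ _ VZ] Vx.
  case: (pselect (exists y, V y /\ y <> 0)) => [[y [Vy ny]]|nV]; last first.
    by left=> y Vy; apply: contrapT => ny; apply: nV; exists y.
  right=> _ [b ->]; apply: (VZ b); have [a yE] := Vx y Vy.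
  have [c [_ ca]] : invertible a.
    by apply: contrapT => /rx ax; apply: ny; rewrite yE.
  by rewrite -[x]scale1r -ca -scalerA -yE; apply: VZ.
- split; first by exists 0; rewrite scale0r.
    by move=> _ _ [a ->] [b ->]; exists (a + b); rewrite scalerDl.
  by move=> b _ [a ->]; exists (b * a); rewrite scalerA.
- by exists x; split=> //; exists 1; rewrite scale1r.
Qed.

End LocalModules.

Lemma invertible_image (R S : pzRingType) (f : R -> S) a :
  f 1 = 1 -> (forall a b, f (a * b) = f a * f b) ->
  invertible a -> invertible (f a).
Proof. by move=> f1 fM [b [ab ba]]; exists (f b); rewrite -!fM ab ba f1. Qed.

(** * Surjective images of local rings, applied to quotient endomorphism rings *)

Section LocalQuotient.
Variables (R S : pzRingType) (f : R -> S).
Hypotheses (locR : local_ring R) (nzS : (1 : S) <> 0).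
Hypotheses (f1 : f 1 = 1) (fM : forall a b, f (a * b) = f a * f b)
  (fB : forall a b, f (a - b) = f a - f b).
Hypothesis f_surj : forall s, exists a, f a = s.

(** Lift an inverse of [f a] to [b]. If [a] is not a unit then [1 - a * b] is one, but its image is
    0, against 1 <> 0 in [S]. *)
Lemma local_image_invertible a : invertible (f a) <-> invertible a.
Proof.
split; last exact: invertible_image.
move=> [s [as1 _]]; apply: contrapT => na; have [b bE] := f_surj s.
have [c [c1 _]] := local_compl locR (local_nonunitMr locR (r := b) na).
have : f ((1 - a * b) * c) = 0 by rewrite fM fB fM bE as1 f1 subrr mul0r.
by rewrite c1 f1.
Qed.

Lemma local_image : local_ring S.
Proof.
split=> // s t; have [a <-] := f_surj s; have [b <-] := f_surj t.
have fD : f (a + b) = f a + f b by apply/eqP; rewrite -subr_eq -fB addrK.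
by rewrite -fD !local_image_invertible; exact: locR.2.
Qed.

End LocalQuotient.

Lemma invertible_op (C : preadditive) (X : C) (a : endo X) :
  invertible (a : endo_op X) <-> invertible a.
Proof. by split=> -[b [ab ba]]; exists b. Qed.

Lemma local_ring_op (C : preadditive) (X : C) :
  local_ring (endo X) -> local_ring (endo_op X).
Proof.
by move=> [nz loc]; split=> // a b; rewrite !invertible_op; exact: loc.
Qed.

Section QuotientEndo.
Variables (C : preadditive) (J : hom_ideal C) (X : C).
Local Notation D := (quotient_category J).
Hypotheses (locX : strongly_indecomposable X) (nzX : (1 : endo (X : D)) <> 0).

Lemma proj_endo_surj (a : endo (X : D)) :
  exists b : endo X, (proj J b : endo (X : D)) = a.
Proof. by exists (repr (a : qhom J X X)); exact: projK. Qed.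

Lemma quotient_strongly_indecomposable : strongly_indecomposable (X : D).
Proof.
apply: (@local_image (endo X) (endo (X : D)) (@proj C J X X) locX) => //.
- by move=> a b; symmetry; exact: qcompE.
- by move=> a b; exact: raddfB.
- exact: proj_endo_surj.
Qed.

Lemma proj_invertible (a : endo X) :
  invertible (proj J a : endo (X : D)) <-> invertible a.
Proof.
apply: (@local_image_invertible (endo X) (endo (X : D)) (@proj C J X X) locX)
  => //.
- by move=> b c; symmetry; exact: qcompE.
- by move=> b c; exact: raddfB.
- exact: proj_endo_surj.
Qed.

End QuotientEndo.

(** * Monomorphisms of functors *)

HB.instance Definition _ (C : preadditive) (X Y Z : C) (g : hom Y Z) :=
  GRing.isZmodMorphism.Build _ _ (@hcomp C X Y Z g) (comp_zmod_morphismr g).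

Definition hom_functor (C : preadditive) (X : C) : abfunctor C :=
  @AbFunctor C (hom X) (fun Y Z g => @hcomp C X Y Z g)
    (fun Y Z => @compDl C X Y Z) (fun Y => @comp1m C X Y)
    (fun Y Z W g f x => esym (compA g f x)).

Section Yoneda.
Variables (C : preadditive) (F : abfunctor C) (X : C) (x : F X).

Definition yoneda_map (Y : C) (f : hom X Y) : F Y := fmap F f x.

Fact yoneda_map_zmod Y : zmod_morphism (@yoneda_map Y).
Proof.
move=> f g; apply: (addIr (yoneda_map g)).
by rewrite subrK /yoneda_map -fmapD subrK.
Qed.

HB.instance Definition _ Y :=
  GRing.isZmodMorphism.Build _ _ (@yoneda_map Y) (@yoneda_map_zmod Y).

Definition yoneda : nattrans (hom_functor X) F.
Proof.
refine (@NatTrans C (hom_functor X) F (fun Y => @yoneda_map Y) _).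
by move=> Y Z f g; exact: fmapM.
Defined.

End Yoneda.

(** By Yoneda, [x] and 0 define transformations from Hom(X, -) to [F]. If [Psi X x = 0] they agree
    after [Psi], hence agree, and evaluation at the identity gives x = 0. *)
Lemma monomorphismP (C : preadditive) (F G : abfunctor C) (Psi : nattrans F G) :
  monomorphism Psi <-> forall X x, Psi X x = 0 -> x = 0.
Proof.
split=> [mPsi X x Px|iPsi H a b ab X x].
  have := mPsi _ (yoneda x) (yoneda (0 : F X)) _ X (idm X).
  rewrite /= /yoneda_map !fmap1; apply=> Y f.
  by rewrite /= /yoneda_map !naturality Px !raddf0.
apply/eqP; rewrite -subr_eq0; apply/eqP/iPsi.
by rewrite raddfB ab subrr.
Qed.

(** * The covariant functor *)

Section Left.
Variables (C : tri_exact) (X Z : C).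
Hypothesis locX : strongly_indecomposable X.
Variables (R : pzRingType) (phi : {rmorphism R -> endo (X : inj_stable C)}).
Hypothesis nzX : (1 : endo (X : inj_stable C)) <> 0.
Variable I : lmodType R.
Hypothesis cogI :
  injective_cogenerator (restrict_scalars phi (topL locX nzX)) I.
Implicit Types L M N : C.

Let locXbar : local_ring (endo (X : inj_stable C)) :=
  quotient_strongly_indecomposable locX nzX.

Lemma topL_separates :
  exists chi : {linear restrict_scalars phi (topL locX nzX) -> I},
    chi (top_pi (1 : endo X)) <> 0.
Proof.
apply: (injective_cogenerator_separates cogI).
rewrite -[0](raddf0 (@top_pi C X)) => /top_piP; rewrite subr0.
by move/(local_jacobsonP locX); apply; exists 1; rewrite mulr1.
Qed.

Lemma dualL_socle_ex : exists t : dualL phi I X,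
  socle (t : dualL phi I (X : inj_stable C)) /\ t <> 0.
Proof.
have [chi chi1] := topL_separates.
pose s : topL locX nzX := top_pi (1 : endo X).
(* [t] is [chi] after the projection of the stable endomorphism ring onto S_X, which sends u to u
   s. *)
have [|t tE] := @linear_ex R
    (restrict_scalars phi (homL (X : inj_stable C) (X : inj_stable C))) I
    (fun u => chi ((u : endo (X : inj_stable C)) *: s)).
  move=> a u v; rewrite -linearP; congr (chi _).
  rewrite [LHS]scalerDl; congr (_ + _); symmetry.
  exact: (scalerA (phi a) (u : endo (X : inj_stable C)) s).
exists (t : dualL phi I X).
have nt : (t : dualL phi I X) <> 0.
  move=> t0; apply: chi1; have := tE (1 : endo (X : inj_stable C)).
  by rewrite t0 scale1r => <-.
split; last exact: nt.

apply: (@annihilated_socle (endo (X : inj_stable C))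
  (dualL phi I (X : inj_stable C)) t nt) => r nr.
apply: linHomP => u.
(* The value of [r *: t] at [u] is chi(u r s), and r s = 0 because [r] lifts to a nonunit, that is,
   to an element of the radical. *)
rewrite [LHS](tE (u \co r)).
rewrite -[_ *: s](scalerA (u : endo (X : inj_stable C)) r s).
rewrite [r *: s](_ : _ = 0) ?scaler0 ?raddf0 //.
have [a aE] := proj_endo_surj r; rewrite -aE.
rewrite [LHS](topL_mulE locX nzX) mulr1; apply/top_pi0/(local_jacobsonP locX).
by move/(proj_invertible locX nzX); rewrite aE.
Qed.

Lemma left_mono_kills_nonsections
  (Psi : nattrans (ext_covariant Z) (dualL_functor phi I)) :
  monomorphism Psi ->
  socle_essential (left_component Psi : {linear extL Z X -> dualL phi I X}) ->
  exists d : ext Z X, d <> 0 /\ kills_nonsections d.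
Proof.
move=> /monomorphismP inj_Psi ess; have [d [sd nd]] := ess dualL_socle_ex.
exists d; split=> [d0|M u nu]; first by apply: nd; rewrite d0 raddf0.
apply: inj_Psi; rewrite [LHS](naturality Psi u d); apply: linHomP => v.
rewrite dualL_mapE; have <- := projK (v : qhom (inj_ideal C) M X).
set v' : hom M X := repr _; rewrite [_ \co _](qcompE (inj_ideal C) v' u).
(* An inverse of [v' \co u] would make [u] a section. *)
have nr : ~ invertible
    (proj (inj_ideal C) (v' \co u) : endo (X : inj_stable C)).
  move/(proj_invertible locX nzX) => [b [_ bvu]].
  by apply: nu; exists ((b : hom X X) \co v'); rewrite -compA.
have rd := socle_annihilated locXbar sd nr.
(* The value of [Psi X d] at v' u is the value at the identity of v' u acting on [Psi X d], and
   nonunits kill the socle. *)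
transitivity
  ((dualL_map (proj (inj_ideal C) (v' \co u)) (Psi X d) : {linear _ -> _})
    (idm (X : inj_stable C))).
  by rewrite dualL_mapE (@comp1m (inj_stable C)).
by rewrite [dualL_map _ _]rd.
Qed.

(** * The natural transformation attached to a linear form on Ext^1(Z, X) *)

Section Pairing.
Variable chi : {linear restrict_scalars phi (extL Z X) -> I}.

Definition ext_push_pairing M (z : ext Z M) (u : qhom (inj_ideal C) M X) :
    extL Z X :=
  ext_push (repr u) z.

(** The representative does not matter, since injectively trivial morphisms act by zero on
    extensions. *)
Lemma ext_push_pairingE M (z : ext Z M) (u : hom M X) :
  ext_push_pairing z (proj (inj_ideal C) u) = ext_push u z.
Proof.
apply/eqP; rewrite -subr_eq0; apply/eqP; rewrite -[LHS]ext_pushB.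
have /projP h : proj (inj_ideal C) (repr (proj (inj_ideal C) u)) =
  proj (inj_ideal C) u by rewrite projK.
exact: h.
Qed.

Lemma ext_push_pairing_linear M (z : ext Z M) :
  linear ((fun u => chi (ext_push_pairing z u)) :
    restrict_scalars phi (homL (M : inj_stable C) (X : inj_stable C)) -> I).
Proof.
move=> a u v /=; rewrite -linearP; congr (chi _).
have <- := projK (u : qhom (inj_ideal C) M X).
have <- := projK (v : qhom (inj_ideal C) M X).
set u' : hom M X := repr _; set v' : hom M X := repr _.
(* Lifting [phi a] to an endomorphism of [X] represents [a *: u + v] by a morphism of [C]. *)
have [b bE] := proj_endo_surj (phi a).
rewrite [X in ext_push_pairing z X](_ : _ =
    proj (inj_ideal C) ((b : hom X X) \co u' + v')).
  rewrite !ext_push_pairingE ext_pushD ext_pushM; congr (_ + _).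
  transitivity (extL_scale (phi a) (ext_push u' z)); last by [].
  by rewrite -bE extL_scaleE.
transitivity
  (proj (inj_ideal C) ((b : hom X X) \co u') + proj (inj_ideal C) v').
  by rewrite -qcompE bE.
by symmetry; exact: (raddfD (@proj C (inj_ideal C) M X)).
Qed.

(** The map u |-> chi(u.z). It is obtained by choice but is unique, a linear map being determined by
    its values. *)
Definition dualL_component M (z : ext Z M) : dualL phi I M :=
  projT1 (cid (linear_ex (@ext_push_pairing_linear M z))).

Lemma dualL_componentE M (z : ext Z M) u :
  (dualL_component z : {linear _ -> _}) (proj (inj_ideal C) u) =
  chi (ext_push u z).
Proof. 
by rewrite /dualL_component; case: cid => t /= ->; rewrite ext_push_pairingE.
Qed.

Fact dualL_component_zmod M : zmod_morphism (@dualL_component M).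
Proof.
move=> y z; apply: linHomP => u; have <- := projK (u : qhom (inj_ideal C) M X).
by rewrite /= !dualL_componentE !raddfB.
Qed.

HB.instance Definition _ M :=
  GRing.isZmodMorphism.Build _ _ (@dualL_component M) (@dualL_component_zmod M).

Definition dualL_nattrans : nattrans (ext_covariant Z) (dualL_functor phi I).
Proof.
refine (@NatTrans C (ext_covariant Z) (dualL_functor phi I)
  (fun M => @dualL_component M) _).
move=> M N f z; apply: linHomP => u.
have <- := projK (u : qhom (inj_ideal C) N X).
rewrite [LHS]dualL_componentE -ext_pushM -dualL_componentE -qcompE.
by [].
Defined.

End Pairing.

Lemma dualL_nattrans_mono (chi : {linear restrict_scalars phi (extL Z X) -> I})
  (d : ext Z X) :
  kills_nonretractions d -> chi d <> 0 -> monomorphism (dualL_nattrans chi).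
Proof.
move=> kd nchi; apply/monomorphismP => M z cz; apply: contrapT => nz.
have [u dE] := kills_nonretractions_factor kd nz.
(* The image of [z] takes the value chi(d) at this [u], but that image is assumed to be zero. *)
by apply: nchi; rewrite dE -dualL_componentE; move: cz => /= ->.
Qed.

Lemma dualL_nattrans_socle_essential
  (chi : {linear restrict_scalars phi (extL Z X) -> I}) (d : ext Z X) :
  kills_nonsections d -> chi d <> 0 ->
  socle_essential
    (left_component (dualL_nattrans chi) : {linear extL Z X -> dualL phi I X}).
Proof.
move=> kd nchi _; exists d.
(* Its value at the identity is chi(d). *)
have nt : left_component (dualL_nattrans chi) d <> 0.
  move=> h; apply: nchi; rewrite -[d in chi d]ext_push1 -dualL_componentE.
  by move: h; rewrite /left_component /= => ->.
split; last exact: nt.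
apply: (@annihilated_socle (endo (X : inj_stable C))
  (dualL phi I (X : inj_stable C)) _ nt) => r nr.
have [a aE] := proj_endo_surj r.
suff d0 : (r : endo (X : inj_stable C)) *: (d : extL Z X) = 0.
  by rewrite -linearZ d0 raddf0.
(* An endomorphism [a] that is a section has a left inverse, so it is a unit of the local ring
   End(X), contrary to [nr]. *)
rewrite -aE [LHS]extL_scaleE; apply: kd => -[b ba].
apply: nr; rewrite -aE; apply/(proj_invertible locX nzX)/(local_linv locX).
exact: ba.
Qed.

Lemma topL_linear_form_extends (d : ext Z X) :
  d <> 0 -> kills_nonsections d ->
  exists chi : {linear restrict_scalars phi (extL Z X) -> I}, chi d <> 0.
Proof.
move=> nz kd.
(* The annihilator of [d] in End(X) is exactly the radical. *)
have kj (a : endo X) : ext_push a d = 0 <-> jacobson a.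
  split=> [ad|/(local_jacobsonP locX) na].
    apply/(local_jacobsonP locX) => -[b [_ ba]]; apply: nz.
    by rewrite -[d]ext_push1 [idm X](_ : _ = b * a) // ext_pushM ad raddf0.
  by apply: kd => -[b ba]; apply: na; apply: (local_linv locX (b := b)).
(* Hence s |-> s.d is a well-defined embedding of S_X into Ext^1(Z, X). *)
pose i0 (s : topL locX nzX) : extL Z X := ext_push (repr (s : simple_top X)) d.
have i0E (a : endo X) : i0 (top_pi a) = ext_push a d.
  apply/eqP; rewrite -subr_eq0 -[_ - _]ext_pushB; apply/eqP/kj/top_piP.
  by rewrite top_piK.
have [|i iE] := @linear_ex R (restrict_scalars phi (topL locX nzX))
    (restrict_scalars phi (extL Z X)) i0.
  move=> a s t; have <- := top_piK s; have <- := top_piK t.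
  set s' : endo X := repr _; set t' : endo X := repr _.
  have [b bE] := proj_endo_surj (phi a).
  transitivity (ext_push (b * s' + t') d).
    rewrite -i0E; congr i0; rewrite raddfD; congr (_ + _).
    transitivity (topL_mul (phi a) (top_pi s')); first by [].
    by rewrite -bE (topL_mulE locX nzX).
  rewrite !i0E ext_pushD ext_pushM; congr (_ + _).
  transitivity (extL_scale (phi a) (ext_push s' d)); last by [].
  by rewrite -bE extL_scaleE.
have i_inj : injective i.
  move=> s t; rewrite !iE; have <- := top_piK s; have <- := top_piK t.
  rewrite !i0E => /eqP; rewrite -subr_eq0 -[_ - _]ext_pushB => /eqP/kj.
  by move/top_piP.
(* The embedding sends the class of 1 to [d], so an extension of a form that is nonzero on that
   class is nonzero at [d]. *)
have [c c1] := topL_separates; have [chi chiE] := cogI.1 _ _ i c i_inj.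
by exists chi; move: c1; rewrite -chiE iE i0E ext_push1.
Qed.

Lemma left_mono_exP (locZ : strongly_indecomposable Z) :
  (exists (Y : C) (f : hom X Y) (g : hom Y Z), almost_split_sequence f g) <->
  exists Psi : nattrans (ext_covariant Z) (dualL_functor phi I),
    monomorphism Psi /\
    socle_essential (left_component Psi : {linear extL Z X -> dualL phi I X}).
Proof.
rewrite (almost_split_sequence_exP locX locZ).
split=> [[d [nz kL kR]]|[Psi [mono ess]]].
  have [chi nchi] := topL_linear_form_extends nz kL.
  exists (dualL_nattrans chi); split; first exact: dualL_nattrans_mono nchi.
  exact: dualL_nattrans_socle_essential nchi.
have [d [nz kL]] := left_mono_kills_nonsections mono ess.
by exists d; split=> //; apply: kills_nonsections_nonretractions.
Qed.

End Left.

(** * The contravariant functor *)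

Section Right.
Variables (C : tri_exact) (X Z : C).
Hypothesis locZ : strongly_indecomposable Z.
Variables (R : pzRingType) (psi : {rmorphism R -> endo_op (Z : proj_stable C)}).
Hypothesis nzZ : (1 : endo (Z : proj_stable C)) <> 0.
Variable I : lmodType R.
Hypothesis cogI :
  injective_cogenerator (restrict_scalars psi (topR locZ nzZ)) I.
Implicit Types L M N : C.

Let locZbar : local_ring (endo_op (Z : proj_stable C)) :=
  local_ring_op (quotient_strongly_indecomposable locZ nzZ).

Lemma topR_separates :
  exists chi : {linear restrict_scalars psi (topR locZ nzZ) -> I},
    chi (top_pi (1 : endo Z)) <> 0.
Proof.
apply: (injective_cogenerator_separates cogI).
rewrite -[0](raddf0 (@top_pi C Z)) => /top_piP; rewrite subr0.
by move/(local_jacobsonP locZ); apply; exists 1; rewrite mulr1.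
Qed.

Lemma dualR_socle_ex : exists t : dualR psi I Z,
  socle (t : dualR psi I (Z : proj_stable C)) /\ t <> 0.
Proof.
have [chi chi1] := topR_separates.
pose s : topR locZ nzZ := top_pi (1 : endo Z).
have [|t tE] := @linear_ex R
    (restrict_scalars psi (homR (Z : proj_stable C) (Z : proj_stable C))) I
    (fun u => chi ((u : endo_op (Z : proj_stable C)) *: s)).
  move=> a u v; rewrite -linearP; congr (chi _).
  rewrite [LHS]scalerDl; congr (_ + _); symmetry.
  exact: (scalerA (psi a) (u : endo_op (Z : proj_stable C)) s).
exists (t : dualR psi I Z).
have nt : (t : dualR psi I Z) <> 0.
  move=> t0; apply: chi1; have := tE (1 : endo_op (Z : proj_stable C)).
  by rewrite t0 scale1r => <-.
split; last exact: nt.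
apply: (@annihilated_socle (endo_op (Z : proj_stable C))
  (dualR psi I (Z : proj_stable C)) t nt) => r nr.
apply: linHomP => u.
rewrite [LHS](tE ((r : hom (Z : proj_stable C) Z) \co u)).
rewrite -[_ *: s](scalerA (u : endo_op (Z : proj_stable C)) r s).
rewrite [r *: s](_ : _ = 0) ?scaler0 ?raddf0 //.
have [a aE] := proj_endo_surj (r : endo (Z : proj_stable C)); rewrite -aE.
(* The action multiplies on the right, so [r] sends the class of 1 to the class of [a], which is in
   the radical. *)
rewrite [LHS](topR_mulE locZ nzZ) mul1r; apply/top_pi0/(local_jacobsonP locZ).
by move/(proj_invertible locZ nzZ)/invertible_op; rewrite aE.
Qed.

Lemma right_mono_kills_nonretractions
  (Phi : nattrans (ext_contravariant X) (dualR_functor psi I)) :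
  monomorphism Phi ->
  socle_essential (right_component Phi : {linear extR Z X -> dualR psi I Z}) ->
  exists d : ext Z X, d <> 0 /\ kills_nonretractions d.
Proof.
move=> /monomorphismP inj_Phi ess; have [d [sd nd]] := ess dualR_socle_ex.
exists d; split=> [d0|M w nw]; first by apply: nd; rewrite d0 raddf0.
apply: inj_Phi; rewrite [LHS](naturality Phi (w : @hom (opposite C) Z M) d).
apply: linHomP => v.
rewrite dualR_mapE; have <- := projK (v : qhom (proj_ideal C) Z M).
set v' : hom Z M := repr _; rewrite [_ \co _](qcompE (proj_ideal C) w v').
(* An inverse of [w \co v'] would make [w] a retraction. *)
have nr : ~ invertible
    (proj (proj_ideal C) (w \co v') : endo_op (Z : proj_stable C)).
  move/invertible_op/(proj_invertible locZ nzZ) => [b [wvb _]].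
  by apply: nw; exists (v' \co (b : hom Z Z)); rewrite compA.
have rd := socle_annihilated locZbar sd nr.
transitivity
  ((dualR_map (proj (proj_ideal C) (w \co v')) (Phi Z d) : {linear _ -> _})
    (idm (Z : proj_stable C))).
  by rewrite dualR_mapE (@compm1 (proj_stable C)).
by rewrite [dualR_map _ _]rd.
Qed.

(** * The contravariant transformation attached to a linear form on Ext^1(Z, X) *)

Section Pairing.
Variable chi : {linear restrict_scalars psi (extR Z X) -> I}.

Definition ext_pull_pairing M (z : ext M X) (u : qhom (proj_ideal C) Z M) :
    extR Z X :=
  ext_pull (repr u) z.

Lemma ext_pull_pairingE M (z : ext M X) (u : hom Z M) :
  ext_pull_pairing z (proj (proj_ideal C) u) = ext_pull u z.
Proof.
apply/eqP; rewrite -subr_eq0; apply/eqP; rewrite -[LHS]ext_pullB.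
have /projP h : proj (proj_ideal C) (repr (proj (proj_ideal C) u)) =
  proj (proj_ideal C) u by rewrite projK.
exact: h.
Qed.

Lemma ext_pull_pairing_linear M (z : ext M X) :
  linear ((fun u => chi (ext_pull_pairing z u)) :
    restrict_scalars psi (homR (Z : proj_stable C) (M : proj_stable C)) -> I).
Proof.
move=> a u v /=; rewrite -linearP; congr (chi _).
have <- := projK (u : qhom (proj_ideal C) Z M).
have <- := projK (v : qhom (proj_ideal C) Z M).
set u' : hom Z M := repr _; set v' : hom Z M := repr _.
have [b bE] := proj_endo_surj (psi a : endo (Z : proj_stable C)).
rewrite [X in ext_pull_pairing z X](_ : _ =
    proj (proj_ideal C) (u' \co (b : hom Z Z) + v')).
  rewrite !ext_pull_pairingE ext_pullD ext_pullM; congr (_ + _).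
  transitivity (extR_scale (psi a) (ext_pull u' z)); last by [].
  by rewrite -bE extR_scaleE.
transitivity
  (proj (proj_ideal C) (u' \co (b : hom Z Z)) + proj (proj_ideal C) v').
  by rewrite -qcompE bE.
by symmetry; exact: (raddfD (@proj C (proj_ideal C) Z M)).
Qed.

Definition dualR_component M (z : ext M X) : dualR psi I M :=
  projT1 (cid (linear_ex (@ext_pull_pairing_linear M z))).

Lemma dualR_componentE M (z : ext M X) u :
  (dualR_component z : {linear _ -> _}) (proj (proj_ideal C) u) =
  chi (ext_pull u z).
Proof.
by rewrite /dualR_component; case: cid => t /= ->; rewrite ext_pull_pairingE.
Qed.

Fact dualR_component_zmod M : zmod_morphism (@dualR_component M).
Proof.
move=> y z; apply: linHomP => u; have <- := projK (u : qhom (proj_ideal C) Z M).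
by rewrite /= !dualR_componentE !raddfB.
Qed.

HB.instance Definition _ M :=
  GRing.isZmodMorphism.Build _ _ (@dualR_component M) (@dualR_component_zmod M).

Definition dualR_nattrans :
  nattrans (ext_contravariant X) (dualR_functor psi I).
Proof.
refine (@NatTrans (opposite C) (ext_contravariant X) (dualR_functor psi I)
  (fun M => @dualR_component M) _).
move=> N M f z; apply: linHomP => u.
have <- := projK (u : qhom (proj_ideal C) Z M).
rewrite [LHS]dualR_componentE -ext_pullM -dualR_componentE -qcompE.
by [].
Defined.

End Pairing.

(** The two conditions on [d] trade places with respect to [dualL_nattrans_mono]: every nonzero [z]
    in Ext^1(M, X) has [d] as a pullback because nonsections kill [d]. *)
Lemma dualR_nattrans_mono (chi : {linear restrict_scalars psi (extR Z X) -> I})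
  (d : ext Z X) :
  kills_nonsections d -> chi d <> 0 -> monomorphism (dualR_nattrans chi).
Proof.
move=> kd nchi; apply/monomorphismP => M z cz; apply: contrapT => nz.
have [u dE] := kills_nonsections_factor kd nz.
by apply: nchi; rewrite dE -dualR_componentE; move: cz => /= ->.
Qed.

Lemma dualR_nattrans_socle_essential
  (chi : {linear restrict_scalars psi (extR Z X) -> I}) (d : ext Z X) :
  kills_nonretractions d -> chi d <> 0 ->
  socle_essential
    (right_component (dualR_nattrans chi) : {linear extR Z X -> dualR psi I Z}).
Proof.
move=> kd nchi _; exists d.
have nt : right_component (dualR_nattrans chi) d <> 0.
  move=> h; apply: nchi; rewrite -[d in chi d]ext_pull1 -dualR_componentE.
  by move: h; rewrite /right_component /= => ->.
split; last exact: nt.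
apply: (@annihilated_socle (endo_op (Z : proj_stable C))
  (dualR psi I (Z : proj_stable C)) _ nt) => r nr.
have [a aE] := proj_endo_surj (r : endo (Z : proj_stable C)).
suff d0 : (r : endo_op (Z : proj_stable C)) *: (d : extR Z X) = 0.
  by rewrite -linearZ d0 raddf0.
rewrite -aE [LHS]extR_scaleE; apply: kd => -[b ab].
apply: nr; rewrite -aE.
(* A retraction has a right inverse in End(Z), which is a left inverse in the converse ring, where
   [local_linv] applies. *)
apply/invertible_op/(proj_invertible locZ nzZ)/invertible_op.
exact: (local_linv (local_ring_op locZ) (b := b : endo_op Z)).
Qed.

Lemma topR_linear_form_extends (d : ext Z X) :
  d <> 0 -> kills_nonretractions d ->
  exists chi : {linear restrict_scalars psi (extR Z X) -> I}, chi d <> 0.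
Proof.
move=> nz kd.
(* The annihilator of [d] in End(Z) is the radical, so a |-> d.a induces an embedding of S_Z into
   Ext^1(Z, X). *)
have kj (a : endo Z) : ext_pull a d = 0 <-> jacobson a.
  split=> [ad|/(local_jacobsonP locZ) na].
    apply/(local_jacobsonP locZ) => -[b [ab _]]; apply: nz.
    by rewrite -[d]ext_pull1 [idm Z](_ : _ = a * b) // ext_pullM ad raddf0.
  apply: kd => -[b ab]; apply/na/invertible_op.
  exact: (local_linv (local_ring_op locZ) (b := b : endo_op Z)).
pose i0 (s : topR locZ nzZ) : extR Z X := ext_pull (repr (s : simple_top Z)) d.
have i0E (a : endo Z) : i0 (top_pi a) = ext_pull a d.
  apply/eqP; rewrite -subr_eq0 -[_ - _]ext_pullB; apply/eqP/kj/top_piP.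
  by rewrite top_piK.
have [|i iE] := @linear_ex R (restrict_scalars psi (topR locZ nzZ))
    (restrict_scalars psi (extR Z X)) i0.
  move=> a s t; have <- := top_piK s; have <- := top_piK t.
  set s' : endo Z := repr _; set t' : endo Z := repr _.
  have [b bE] := proj_endo_surj (psi a : endo (Z : proj_stable C)).
  transitivity (ext_pull (s' * b + t') d).
    rewrite -i0E; congr i0; rewrite raddfD; congr (_ + _).
    transitivity (topR_mul (psi a : endo (Z : proj_stable C)) (top_pi s')).
      by [].
    by rewrite -bE (topR_mulE locZ nzZ).
  rewrite !i0E ext_pullD ext_pullM; congr (_ + _).
  transitivity (extR_scale (psi a) (ext_pull s' d)); last by [].
  by rewrite -bE extR_scaleE.
have i_inj : injective i.
  move=> s t; rewrite !iE; have <- := top_piK s; have <- := top_piK t.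
  rewrite !i0E => /eqP; rewrite -subr_eq0 -[_ - _]ext_pullB => /eqP/kj.
  by move/top_piP.
have [c c1] := topR_separates; have [chi chiE] := cogI.1 _ _ i c i_inj.
by exists chi; move: c1; rewrite -chiE iE i0E ext_pull1.
Qed.

Lemma right_mono_exP (locX : strongly_indecomposable X) :
  (exists (Y : C) (f : hom X Y) (g : hom Y Z), almost_split_sequence f g) <->
  exists Phi : nattrans (ext_contravariant X) (dualR_functor psi I),
    monomorphism Phi /\
    socle_essential (right_component Phi : {linear extR Z X -> dualR psi I Z}).
Proof.
rewrite (almost_split_sequence_exP locX locZ).
split=> [[d [nz kL kR]]|[Phi [mono ess]]].
  have [chi nchi] := topR_linear_form_extends nz kR.
  exists (dualR_nattrans chi); split; first exact: dualR_nattrans_mono nchi.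
  exact: dualR_nattrans_socle_essential nchi.
have [d [nz kR]] := right_mono_kills_nonretractions mono ess.
by exists d; split=> //; apply: kills_nonretractions_nonsections.
Qed.

End Right.

(** * Equivalence of the almost split condition with its two functorial forms *)

Theorem theorem3p7 (C : tri_exact) (X Z : C)
  (hX : strongly_indecomposable X) (hZ : strongly_indecomposable Z)
  (Gamma Sigma : pzRingType)
  (phi : {rmorphism Gamma -> endo (X : inj_stable C)})
  (psi : {rmorphism Sigma -> endo (Z : proj_stable C)})
  (hphi : nonzero_morphism phi) (hpsi : nonzero_morphism psi)
  (I : lmodType Gamma) (J : lmodType Sigma^c)
  (hI : injective_cogenerator
          (restrict_scalars phi (topL hX (nonzero_morphism_codomain hphi))) I)
  (hJ : injective_cogenerator
          (restrict_scalars (rmorph_op psi)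
             (topR hZ (nonzero_morphism_codomain hpsi))) J) :
  let almost_split_exists :=
    exists (Y : C) (f : hom X Y) (g : hom Y Z), almost_split_sequence f g in
  let left_mono_exists :=
    exists Psi : nattrans (ext_covariant Z) (dualL_functor phi I),
      monomorphism Psi /\
      socle_essential (left_component Psi : {linear extL Z X -> dualL phi I X})
  in
  let right_mono_exists :=
    exists Phi : nattrans (ext_contravariant X)
                   (dualR_functor (rmorph_op psi) J),
      monomorphism Phi /\
      socle_essential
        (right_component Phi :
           {linear extR Z X -> dualR (rmorph_op psi) J Z}) in
  (almost_split_exists <-> left_mono_exists) /\
  (almost_split_exists <-> right_mono_exists).
Proof.
by split; [exact: (left_mono_exP hI hZ) | exact: (right_mono_exP hJ hX)].
Qed.
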